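(* For all $\theta=(\nu,Q,(f_x)_{x\in\mathbb{X}})\in\Theta^{\mathrm{ind}}$ and all $n\ge1$, $$\inf_{g\in\mathcal{G}_n}\mathcal{R}_n^{\mathrm{clust}}(\theta,g)\ge\inf_{h\in\mathcal{H}_n}\mathcal{R}_n^{\mathrm{class}}(\theta,h)-\sqrt{\frac{\log(J!)}{2n}},$$ and, with $\beta=\min_{j\ne k}(\nu_j+\nu_k)$, assumed positive for this second bound, and $\xi_n=\frac{4e}{\beta}\left[\sqrt{\log(J!)/(2n)}\right]^{1-4/(n\beta)}$, $$\inf_{g\in\mathcal{G}_n}\mathcal{R}_n^{\mathrm{clust}}(\theta,g)\ge(1-\xi_n)\inf_{h\in\mathcal{H}_n}\mathcal{R}_n^{\mathrm{class}}(\theta,h)-J^2e^{-n\beta/8}.$$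
   Context: Model. $J\ge2$ is an integer, $\mathbb{X}=\{1,\dots,J\}$, $(\mathbb{Y},\mathcal{Y})$ is a Polish space with its Borel $\sigma$-field and $\mathcal{L}$ is a dominating ($\sigma$-finite) measure on it. A parameter is $\theta=(\nu,Q,(f_x)_{x\in\mathbb{X}})$ with $\nu$ a probability vector on $\mathbb{X}$, $Q$ a $J\times J$ transition matrix and $f_x$ probability densities with respect to $\mathcal{L}$. Under $\mathbb{P}_\theta$ (expectation $\mathbb{E}_\theta$), $(X_i)_{i\ge1}$ is a Markov chain on $\mathbb{X}$ with initial law $\nu$ and transition matrix $Q$ and, conditionally on $(X_i)_{i\ge 1}$, the $Y_i$ are independent, $Y_i$ having density $f_{X_i}$. $Y_{1:n}=(Y_1,\dots,Y_n)$. $\Theta^{\mathrm{ind}}$ is the set of parameters for which all rows of $Q$ equal $\nu$ (so the $X_i$ are i.i.d. with law $\nu$). Risks. $\mathcal{P}[n]$ is the set of partitions of $[n]=\{1,\dots,n\}$. $\mathcal{G}_n$ is the set of measurable maps $g:\mathbb{Y}^n\to\mathcal{P}[n]$ (clusterers) and $\mathcal{H}_n$ the set of measurable maps $h=(h_1,\dots,h_n):\mathbb{Y}^n\to\mathbb{X}^n$ (classifiers). $\Pi_n$ is the partition of $[n]$ into the nonempty sets among $\{i:X_i=x\}$, $x\in\mathbb{X}$. For partitions $A,B$ of $[n]$, $\ell(A,B)=1-\frac1n\sup_M\sum_{\{C,C'\}\in M}\mathrm{Card}(C\cap C')$, the supremum being over matchings $M$ between the blocks of $A$ and the blocks of $B$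 in the complete bipartite graph (each block is in at most one edge). $\mathcal{R}_n^{\mathrm{clust}}(\theta,g)=\mathbb{E}_\theta[\ell(g(Y_{1:n}),\Pi_n)]$ and $\mathcal{R}_n^{\mathrm{class}}(\theta,h)=\mathbb{E}_\theta[\frac1n\sum_{i=1}^n\mathbf{1}_{h_i(Y_{1:n})\ne X_i}]$. *)

(* Defs.v *)
From HB Require Import structures.
From mathcomp Require Import all_boot all_order all_algebra.
From mathcomp Require Import all_classical all_reals all_analysis.

Set Implicit Arguments.
Unset Strict Implicit.
Unset Printing Implicit Defensive.

Import Order.TTheory GRing.Theory Num.Theory.
Import numFieldNormedType.Exports.

Local Open Scope ring_scope.

Section Partitions.
Context {n : nat}.
Implicit Types (A B : {set {set 'I_n}}) (M : {set {set 'I_n} * {set 'I_n}}).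

(* An edge of the complete bipartite graph on the blocks of A and the blocks
   of B is an ordered pair, so that a block common to A and B gives two
   distinct vertices, one on each side. *)
Definition matching A B M : bool :=
  (M \subset finset.setX A B) &&
  [forall e in M, forall e' in M,
     ((e.1 == e'.1) || (e.2 == e'.2)) ==> (e == e')].

Definition clust_loss (R : realType) A B : R :=
  1 - n%:R^-1 *
      (\max_(M | matching A B M) \sum_(e in M) #|e.1 :&: e.2|)%N%:R.

Definition label_partition (J : nat) (x : 'I_n -> 'I_J) : {set {set 'I_n}} :=
  ([set [set i | x i == k] | k : 'I_J] :\ finset.set0)%SET.

End Partitions.
Arguments clust_loss {n} R A B.

Local Open Scope classical_set_scope.

Definition polish (R : realType) (Y : topologicalType) : Prop :=
  (exists2 D : set Y, countable D & dense D) /\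
  exists m : Y -> Y -> R,
    [/\ forall x y, m x y = 0 <-> x = y,
        forall x y, m x y = m y x,
        forall x y z, m x z <= m x y + m y z,
        forall U : set Y, open U <->
          forall x, U x -> exists2 e : R, 0 < e & [set y | m x y < e] `<=` U &
        forall u : nat -> Y,
          (forall e : R, 0 < e -> exists N : nat, forall i j : nat,
             (N <= i)%N -> (N <= j)%N -> m (u i) (u j) < e) ->
          exists l : Y, u @ \oo --> l].

Notation borel Y := (g_sigma_algebraType (@open Y)).

Record hmm_param (R : realType) (J : nat) (Y : ptopologicalType)
    (L : {sigma_finite_measure set (borel Y) -> \bar R}) := HmmParam {
  nu : 'rV[R]_J;
  Q : 'M[R]_J;
  dens : 'I_J -> borel Y -> R;
  nu_ge0 : forall x, 0 <= nu ord0 x;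
  nu_sum1 : \sum_x nu ord0 x = 1;
  Q_ge0 : forall x x', 0 <= Q x x';
  Q_sum1 : forall x, \sum_x' Q x x' = 1;
  measurable_dens : forall x, measurable_fun setT (dens x);
  dens_ge0 : forall x y, 0 <= dens x y;
  dens_int1 : forall x, (\int[L]_y (dens x y)%:E = 1)%E
}.

Definition theta_ind (R : realType) (J : nat) (Y : ptopologicalType)
    (L : {sigma_finite_measure set (borel Y) -> \bar R})
    (theta : hmm_param J L) : Prop :=
  forall x, row x (Q theta) = nu theta.

(* Measurability for the discrete sigma-field on a finite codomain. *)
Definition measurable_discrete (d : measure_display) (T : measurableType d)
    (F : finType) (f : T -> F) : Prop :=
  forall a, measurable (f @^-1` [set a]).

Section HMM.
Context {R : realType} {J : nat} {Y : ptopologicalType}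
  {L : {sigma_finite_measure set (borel Y) -> \bar R}}.
Context {dO : measure_display} {Omega : measurableType dO}.
Variables (theta : hmm_param J L) (P : probability Omega R).
(* Time is indexed from 0: Xs i and Ys i are the variables number i + 1. *)
Variables (Xs : nat -> Omega -> 'I_J) (Ys : nat -> Omega -> borel Y).

Definition markov_chain : Prop :=
  (forall x, P (Xs 0%N @^-1` [set x]) = (nu theta ord0 x)%:E) /\
  (forall (n : nat) (x : nat -> 'I_J),
     P [set w | forall i, (i <= n.+1)%N -> Xs i w = x i] =
     (P [set w | forall i, (i <= n)%N -> Xs i w = x i] *
      (Q theta (x n) (x n.+1))%:E)%E).

Definition chain_sigma : set (set Omega) :=
  <<s [set B | exists i x, B = Xs i @^-1` [set x]] >>.

(* P (Ys 0 \in A_0, ..., Ys n.-1 \in A_n.-1 | sigma(Xs)) is a.s. the product of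
   the \int[L]_(y in A_i) f_{Xs i} y, stated through the defining property of
   conditional probabilities. *)
Definition cond_emissions : Prop :=
  forall (n : nat) (A : 'I_n -> set (borel Y)),
    (forall i, measurable (A i)) ->
    forall B, chain_sigma B ->
      P (B `&` [set w | forall i : 'I_n, A i (Ys i w)]) =
      (\int[P]_(w in B)
         (\prod_(i < n) (\int[L]_(y in A i) dens theta (Xs i w) y)%R)%:E)%E.

(* P_theta is rendered as any probability P carrying processes with the law
   prescribed by theta; the risks below depend on that joint law only. *)
Definition is_hmm : Prop :=
  [/\ forall i, measurable_discrete (Xs i),
      forall i, measurable_fun setT (Ys i),
      markov_chain & cond_emissions].

Variable n : nat.

Definition obs (w : Omega) : n.-tuple (borel Y) := [tuple Ys i w | i < n].

Definition clust_risk (g : n.-tuple (borel Y) -> {set {set 'I_n}}) : \bar R :=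
  'E_P[fun w => clust_loss R (g (obs w))
                             (label_partition (fun i : 'I_n => Xs i w))]%E.

Definition class_risk (h : n.-tuple (borel Y) -> n.-tuple 'I_J) : \bar R :=
  'E_P[fun w => (n%:R^-1 *
                 \sum_(i < n) (tnth (h (obs w)) i != Xs i w)%:R)%R]%E.

End HMM.

Definition clusterers (Y : ptopologicalType) (n : nat) :
    set (n.-tuple (borel Y) -> {set {set 'I_n}}) :=
  [set g | (forall y, finset.partition (g y) finset.setT) /\
           measurable_discrete g].

Definition classifiers (Y : ptopologicalType) (J n : nat) :
    set (n.-tuple (borel Y) -> n.-tuple 'I_J) :=
  [set h | measurable_discrete h].

Arguments clusterers Y n : clear implicits.
Arguments classifiers Y J n : clear implicits.

Section Constants.
Context {R : realType} {J : nat}.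
Variable nu : 'rV[R]_J.

(* For J >= 2 the set is finite and nonempty, so inf is a minimum. *)
Definition beta : R :=
  inf [set nu ord0 jk.1 + nu ord0 jk.2 | jk in [set jk | jk.1 != jk.2]].

Definition xi (n : nat) : R :=
  4 * expR 1 / beta *
  Num.sqrt (ln (J`!)%:R / (2 * n%:R)) `^ (1 - 4 / (n%:R * beta)).

End Constants.

(* Main.v *)
(* Given the observations, the labels are independent with explicit posterior
   laws p_i, so both risks are averages, over the observations, of expectations
   under a product law on a finite set; for a fixed partition of [n] the clusterer
   is compared with the classifier giving each block C its most likely label, whose
   expected number of errors is m.

   A matching is an injection sigma from labels to blocks, of score
   S(sigma) = sum_k N_k(sigma k), where N_k(C) counts the label k in C.  Expanding
   the exponentials over partial injections gives
     E exp(t max S) <= J! prod_C max_k E exp(t N_k(C)),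
   since the blocks are independent.  Hoeffding's lemma turns this into the first
   bound, and a Poisson-type estimate with t = xi gives
     n - E max S >= (1 - xi) m   as soon as   xi^2 m >= 2 log J!.

   For smaller m, let tau k be the largest block that the classifier labels k.  If
   the other blocks have total size at least 2m, the loss is at least m.  Otherwise
   the loss W of tau has mean at most 3m.  If N_j + N_k >= 2a for all j <> k, with
   a = n beta / 4, an optimal sigma either moves at least two labels and gains at
   most 2 (W - a)^+, or moves one label to an unused block, and the expected gain of
   such moves is at most the excess of E W over m, up to the event W >= a.  A
   Chernoff bound for W makes the tail terms smaller than xi m, and the law of the
   counts N_j + N_k accounts for J^2 exp(- n beta / 8). *)
From HB Require Import structures.
Require Import Defs.
From mathcomp Require Import all_boot all_order all_algebra.
From mathcomp Require Import all_classical all_reals all_analysis.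
From mathcomp Require Import measurable_realfun.
From mathcomp Require Import ring lra zify.

Set Implicit Arguments.
Unset Strict Implicit.
Unset Printing Implicit Defensive.

Import Order.TTheory GRing.Theory Num.Theory.
Import numFieldNormedType.Exports.

Local Open Scope classical_set_scope.
Local Open Scope ring_scope.

(** * Expectations under a product law on a finite power *)

Section FiniteProduct.
Context {R : realType} {I K : finType}.
Variable p : I -> K -> R.
Hypothesis p_ge0 : forall i k, 0 <= p i k.
Hypothesis p_sum1 : forall i, \sum_k p i k = 1.
Implicit Types (F G : {ffun I -> K} -> R) (x : {ffun I -> K}).

Definition prodw x : R := \prod_i p i (x i).

Definition fE F : R := \sum_x prodw x * F x.

Lemma prodw_ge0 x : 0 <= prodw x.
Proof. by apply: prodr_ge0 => i _; exact: p_ge0. Qed.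

Lemma eq_fE F G : (forall x, F x = G x) -> fE F = fE G.
Proof. by move=> FG; apply: eq_bigr => x _; rewrite FG. Qed.

Lemma le_fE F G : (forall x, F x <= G x) -> fE F <= fE G.
Proof. by move=> FG; apply: ler_sum => x _; rewrite ler_wpM2l ?prodw_ge0. Qed.

Lemma fE_prod (g : I -> K -> R) :
  fE (fun x => \prod_i g i (x i)) = \prod_i \sum_k p i k * g i k.
Proof.
rewrite bigA_distr_bigA /fE; apply: eq_bigr => x _.
by rewrite /prodw -big_split.
Qed.

Lemma fEZ c F : fE (fun x => c * F x) = c * fE F.
Proof. by rewrite /fE mulr_sumr; apply: eq_bigr => x _; rewrite mulrCA. Qed.

Lemma fED F G : fE (fun x => F x + G x) = fE F + fE G.
Proof. by rewrite /fE -big_split; apply: eq_bigr => x _; rewrite mulrDr. Qed.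

Lemma fEN F : fE (fun x => - F x) = - fE F.
Proof. by rewrite /fE -sumrN; apply: eq_bigr => x _; rewrite mulrN. Qed.

Lemma fEB F G : fE (fun x => F x - G x) = fE F - fE G.
Proof. by rewrite fED fEN. Qed.

Lemma fE_cst c : fE (fun=> c) = c.
Proof.
have := fE_prod (fun _ _ => 1).
rewrite [RHS]big1 => [|i _]; last first.
  by under eq_bigr do rewrite mulr1; exact: p_sum1.
move=> fE1; transitivity (c * fE (fun x => \prod_(i : I) 1)); last first.
  by rewrite fE1 mulr1.
by rewrite -fEZ; apply: eq_fE => x; rewrite big1_eq mulr1.
Qed.

Lemma fE_sum (T : Type) (s : seq T) (Q : pred T) (F : T -> {ffun I -> K} -> R) :
  fE (fun x => \sum_(t <- s | Q t) F t x) = \sum_(t <- s | Q t) fE (F t).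
Proof.
by rewrite /fE exchange_big; apply: eq_bigr => x _; rewrite mulr_sumr.
Qed.

Lemma fE_ge0 F : (forall x, 0 <= F x) -> 0 <= fE F.
Proof. by move=> F0; rewrite -(fE_cst 0); exact: le_fE. Qed.

Definition resample x i k : {ffun I -> K} :=
  [ffun l => if l == i then k else x l].

Lemma resampleE x i k : resample x i k i = k.
Proof. by rewrite ffunE eqxx. Qed.

(* [(x, k) |-> (x with i := k, x i)] is a weight-preserving involution. *)
Lemma fE_resample i F : fE F = fE (fun x => \sum_k p i k * F (resample x i k)).
Proof.
transitivity (\sum_(xk : {ffun I -> K} * K)
    prodw (xk.1) * p i xk.2 * F xk.1).
  rewrite -(pair_bigA _ (fun x k => prodw x * p i k * F x)) /=.
  apply: eq_bigr => x _.
  by rewrite -mulr_suml -mulr_sumr p_sum1 mulr1.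
pose h (xk : {ffun I -> K} * K) := (resample xk.1 i xk.2, xk.1 i).
have hK : involutive h.
  move=> [x k]; rewrite /h /= resampleE; congr pair.
  by apply/ffunP => l; rewrite !ffunE; case: eqP => // ->.
rewrite (reindex_inj (inv_inj hK)) /=.
rewrite -(pair_bigA _ (fun x k =>
  prodw (resample x i k) * p i (x i) * F (resample x i k))) /=.
apply: eq_bigr => x _; rewrite mulr_sumr; apply: eq_bigr => k _.
rewrite mulrA; congr (_ * _).
rewrite /prodw (bigD1 i) //= [in RHS](bigD1 i) //= resampleE.
rewrite (eq_bigr (fun l => p l (x l))) => [|l /negbTE li]; last first.
  by rewrite ffunE li.
ring.
Qed.

Lemma fE_coord i (g : K -> R) : fE (fun x => g (x i)) = \sum_k p i k * g k.
Proof.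
rewrite (fE_resample i) -[RHS]fE_cst.
by apply: eq_fE => x; apply: eq_bigr => k _; rewrite resampleE.
Qed.

Lemma fE_ind i j : fE (fun x => (x i == j)%:R) = p i j.
Proof.
rewrite (fE_coord i (fun k => (k == j)%:R)) (bigD1 j) //= eqxx mulr1.
by rewrite big1 ?addr0 // => k /negbTE->; rewrite mulr0.
Qed.

(** By independence, conditioning on the label of [i] amounts to overwriting it: the other
    coordinates keep their law. *)
Lemma fE_ind_mul i j F :
  fE (fun x => (x i == j)%:R * F x) = p i j * fE (fun x => F (resample x i j)).
Proof.
rewrite (fE_resample i) -fEZ; apply: eq_fE => x.
rewrite (bigD1 j) //= resampleE eqxx mul1r big1 ?addr0 // => k /negbTE kj.
by rewrite resampleE kj mul0r mulr0.
Qed.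

(* Jensen's inequality for [ln], from the tangent to [expR] at [b]. *)
Lemma fE_expR_le F b : fE (fun x => expR (F x)) <= expR b -> fE F <= b.
Proof.
move=> Fb; have : expR b * (1 + fE F - b) <= expR b.
  apply: le_trans Fb; rewrite -{1}(fE_cst 1) -{1}[X in _ - X](fE_cst b).
  rewrite -fED -fEB -fEZ; apply: le_fE => x.
  rewrite -[in leRHS](subrK b (F x)) expRD mulrC ler_wpM2r ?expR_ge0//.
  by rewrite -addrA expR_ge1Dx.
rewrite -[leRHS]mulr1 ler_pM2l ?expR_gt0//; lra.
Qed.

End FiniteProduct.

(** * Matchings as assignments of blocks to labels *)

Section Assignments.
Context {I K : finType}.
Local Open Scope set_scope.
Implicit Types (c : {set {set I}}) (sigma : K -> {set I}) (x : {ffun I -> K}).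

Definition label_class x k : {set I} := [set i | x i == k].

(* A partial matching between labels and blocks, in which an unmatched label is
   sent to the empty set. *)
Definition assignment c sigma : Prop :=
  (forall k, sigma k \in finset.set0 |: c) /\
  (forall k l, sigma k = sigma l -> sigma k != finset.set0 -> k = l).

Definition score x sigma : nat := \sum_k #|sigma k :&: label_class x k|.

End Assignments.

Section MatchingAssignment.
Context {n J : nat}.
Local Open Scope set_scope.
Implicit Types (c : {set {set 'I_n}}) (x : {ffun 'I_n -> 'I_J}).

Lemma mem_label_partition x B :
  B \in label_partition x -> exists2 i, B = label_class x (x i) & i \in B.
Proof.
move=> /finset.setD1P[B0 /imsetP[k _ Bk]].
have /finset.set0Pn[i iB] := B0; exists i => //.
by move: iB; rewrite Bk finset.inE => /eqP->.
Qed.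

(** Each label receives the block matched to its class, or the empty set if there is none. Classes
    in the partition are nonempty and edges share no endpoint, so each edge comes from exactly one
    label. *)
Lemma matching_assignment c x M : matching c (label_partition x) M ->
  exists2 sigma : 'I_J -> {set 'I_n}, assignment c sigma &
    (\sum_(e in M) #|e.1 :&: e.2| <= score x sigma)%N.
Proof.
move=> /andP[/fintype.subsetP Mc /forall_inP Minj].
have edge_inj e e' : e \in M -> e' \in M ->
    (e.1 == e'.1) || (e.2 == e'.2) -> e = e'.
  by move=> eM e'M ee'; have /forall_inP/(_ e' e'M)/implyP/(_ ee')/eqP := Minj e eM.
pose Q k e := (e \in M) && (e.2 == label_class x k).
pose sigma k := if [pick e | Q k e] is Some e then e.1 else finset.set0.
exists sigma.
  split=> [k|k l]; rewrite /sigma.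
    case: pickP => [e /andP[/Mc] + _|_]; rewrite !finset.inE ?eqxx//.
    by move=> /andP[-> _]; rewrite orbT.
  case: pickP => [e /andP[eM /eqP e2]|_]; last by rewrite eqxx.
  case: pickP => [e' /andP[e'M /eqP e'2] ee' _|_ ->]; last by rewrite eqxx.
  (* A common block forces a common edge, and any point of its nonempty class carries both
     labels. *)
  have E : e = e' by apply: edge_inj => //; rewrite ee' eqxx.
  have := Mc _ eM; rewrite finset.inE => /andP[_ /mem_label_partition[i _ ie]].
  move: (ie); rewrite e2 finset.inE => /eqP <-.
  by move: ie; rewrite E e'2 finset.inE => /eqP.
apply: (@leq_trans (\sum_(e in M) \sum_(k | e.2 == label_class x k)
    #|e.1 :&: e.2|)).
  apply: leq_sum => e eM.
  have := Mc _ eM; rewrite finset.inE => /andP[_ /mem_label_partition[i eE _]].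
  by rewrite (bigD1 (x i)) ?leq_addr//= -eE.
rewrite (exchange_big_dep predT) //=; apply: leq_sum => k _.
rewrite /sigma; case: pickP => [e Qe|Q0]; last by rewrite big_pred0.
have /andP[eM /eqP e2] := Qe.
rewrite (big_pred1 e) ?e2// => e' /=; apply/idP/eqP => [|->]; last exact: Qe.
by move=> /andP[e'M /eqP e'2]; apply: edge_inj => //; rewrite e2 e'2 eqxx orbT.
Qed.

Lemma clust_loss_assignment (R : realType) c x :
  exists2 sigma : 'I_J -> {set 'I_n}, assignment c sigma &
    1 - n%:R^-1 * (score x sigma)%:R <= clust_loss R c (label_partition x).
Proof.
have M0 : matching c (label_partition x) finset.set0.
  rewrite /matching finset.sub0set /=.
  by apply/forall_inP => e; rewrite finset.inE.
have [M Mm ->] : exists2 M, matching c (label_partition x) M &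
    clust_loss R c (label_partition x) =
    1 - n%:R^-1 * (\sum_(e in M) #|e.1 :&: e.2|)%N%:R.
  rewrite /clust_loss (bigop.bigmax_eq_arg finset.set0)//.
  by case: arg_maxnP => // M Mm _; exists M.
have [sigma sc le] := matching_assignment Mm.
exists sigma => //; rewrite lerD2l lerN2 ler_wpM2l ?invr_ge0 ?ler0n//.
by rewrite ler_nat.
Qed.

End MatchingAssignment.

(** * Domination of products along an assignment by a sum over partial injections *)

Section Potential.
Context {R : realType} {I K : finType}.
Local Open Scope set_scope.
Implicit Types (s : seq {set I}) (U : {set K}) (a : K -> {set I} -> R).

(* Sum, over the partial injections from the labels of [U] to the blocks of
   [s], of the products of the [a k C], weighted by the number of ways to
   extend the injection to a permutation when [s] is short. *)
Fixpoint potential a s U : R :=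
  if s is C :: s' then
    potential a s' U + \sum_(k in U) a k C * potential a s' (U :\ k)
  else (#|U|)`!%:R.

Lemma potential_ge0 a s U : (forall k C, 0 <= a k C) -> 0 <= potential a s U.
Proof.
move=> a0; elim: s U => [|C s IH] U /=; first exact: ler0n.
by rewrite addr_ge0// sumr_ge0// => k _; rewrite mulr_ge0.
Qed.

(** Deleting a label drops nonnegative terms and lowers the final factorial; deletions commute, so
    the induction passes through the remaining terms. *)
Lemma potential_mono a s U k : (forall k C, 0 <= a k C) ->
  potential a s (U :\ k) <= potential a s U.
Proof.
move=> a0; elim: s U => [|C s IH] U /=.
  by rewrite ler_nat leq_fact// subset_leq_card// finset.subD1set.
apply: lerD => //; rewrite [leRHS](bigID (mem (U :\ k))) /=.
rewrite -[leLHS]addr0; apply: lerD; last first.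
  by apply: sumr_ge0 => l _; rewrite mulr_ge0 ?potential_ge0.
rewrite [leRHS](eq_bigl (mem (U :\ k))) => [|l]; last first.
  by rewrite !finset.inE andbCA andbb.
apply: ler_sum => l _; rewrite ler_wpM2l//.
have -> : U :\ k :\ l = U :\ l :\ k by rewrite finset.setDDl finset.setUC -finset.setDDl.
exact: IH.
Qed.

(** Induction on the blocks. At most one label [k] uses a nonempty head block [C], and its factor
    [1 + a k C] splits into the branch that skips [C] and the branch that gives [C] to [k]. In the
    other cases the skipping branch suffices. *)
Lemma prod_le_potential a s U (sigma : K -> {set I}) :
  (forall k C, 0 <= a k C) -> (forall k, a k finset.set0 = 0) ->
  (forall k, k \in U -> sigma k != finset.set0 -> sigma k \in s) ->
  {in U &, forall k l, sigma k = sigma l -> sigma k != finset.set0 -> k = l} ->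
  \prod_(k in U) (1 + a k (sigma k)) <= potential a s U.
Proof.
move=> a0 a_set0; elim: s U => [|C s IH] U sU inj /=.
  rewrite big1 ?ler1n ?fact_gt0// => k kU.
  have [->|] := eqVneq (sigma k) finset.set0; first by rewrite a_set0 addr0.
  by move=> /(sU _ kU); rewrite in_nil.
have sum0 (Q : pred K) : 0 <= \sum_(k | Q k) a k C * potential a s (U :\ k).
  by apply: sumr_ge0 => k _; rewrite mulr_ge0 ?potential_ge0.
case: (pickP [pred k | (k \in U) && (sigma k == C) && (C != finset.set0)])
  => [k /= /andP[/andP[kU /eqP kC] C0]|none].
  rewrite (big_setD1 k)//= kC.
  rewrite [in leRHS](bigD1 k)//= addrA.
  apply: (@le_trans _ _ (potential a s U + a k C * potential a s (U :\ k))); last first.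
    by rewrite lerDl sum0.
  rewrite mulrDl mul1r.
  have H : \prod_(i in U :\ k) (1 + a i (sigma i)) <= potential a s (U :\ k).
    apply: IH => [l /finset.setD1P[lk lU] l0|l m /finset.setD1P[_ lU] /finset.setD1P[_ mU]];
      last exact: inj.
    move: (sU l lU l0); rewrite in_cons => /orP[/eqP lC|//].
    by move: lk; rewrite (inj l k)// ?eqxx// lC kC.
  by rewrite lerD ?ler_wpM2l// (le_trans H)// potential_mono.
rewrite -[leLHS]addr0; apply: lerD; last first.
  exact: (sum0 (mem U)).
apply: IH => // k kU k0; move: (sU k kU k0); rewrite in_cons => /orP[/eqP kC|//].
by have := none k; rewrite /= kU kC eqxx -kC k0.
Qed.

End Potential.

(** * Hoeffding's lemma for a Bernoulli variable *)

Section HoeffdingLemma.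
Context {R : realType}.
Implicit Types p t : R.

Lemma ge0_derive_ge (f df : R -> R) t : (forall u : R, is_derive u 1 f (df u)) ->
  (forall u, 0 <= u -> 0 <= df u) -> 0 <= t -> f 0 <= f t.
Proof.
move=> fd df0 t0; apply: (@ger0_derive1_ndecry _ f 0) => //.
  by move=> u; rewrite in_itv/= andbT derive1E => u0; rewrite derive_val df0// ltW.
by apply: continuous_subspaceT => u; apply/differentiable_continuous/derivable1_diffP.
Qed.

Lemma expR_ge1DxD t : 0 <= t -> 1 + t + t ^+ 2 / 2 <= expR t.
Proof.
pose f (u : R) := expR u - u - u ^+ 2 / 2.
move=> t0; have : f 0 <= f t.
  apply: (@ge0_derive_ge f (fun u => expR u - 1 - u) t _ _ t0) => u.
    by rewrite /f; apply: is_derive_eq; rewrite /GRing.scale /=; field.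
  by move=> _; have := expR_ge1Dx u; lra.
by rewrite /f expR0; lra.
Qed.

(** [expR t * den p t] is the Laplace transform at [t] of a Bernoulli variable of parameter [p]. *)
Let den p t : R := (1 - p) * expR (- t) + p.

Let den_gt0 p t : 0 <= p <= 1 -> 0 < den p t.
Proof.
move=> /andP[p0 p1]; rewrite /den.
have := expR_gt0 (- t); have [->|pne0] := eqVneq p 0; first by nra.
have : 0 < p by rewrite lt_def pne0.
nra.
Qed.

Let is_derive_den p t : is_derive t 1 (den p) (- ((1 - p) * expR (- t))).
Proof.
by rewrite /den; apply: is_derive_eq; rewrite /GRing.scale /=; ring.
Qed.

(** Derivative in [t] of the logarithm of the ratio of the two sides of Hoeffding's inequality. It
    vanishes at 0 and is itself shown to increase. *)
Let slope p t : R := p + t / 4 - p * (den p t)^-1.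

Let slope_ge0 p t : 0 <= p <= 1 -> 0 <= t -> 0 <= slope p t.
Proof.
move=> p01 t0; have -> : 0 = slope p 0.
  by rewrite /slope /den oppr0 expR0 mulr1 subrK; field.
have d0 u : den p u != 0 by rewrite gt_eqF ?den_gt0.
pose ds u := 4^-1 - p * (1 - p) * expR (- u) / den p u ^+ 2.
apply: (@ge0_derive_ge _ ds) => // u; last first.
  move=> _; rewrite subr_ge0 ler_pdivrMr ?exprn_gt0 ?den_gt0// /den.
  (* This is [4 * x * y <= (x + y) ^+ 2] for the two terms [x] and [y] of [den p u]. *)
  by have := sqr_ge0 ((1 - p) * expR (- u) - p); nra.
have ? := d0 u.
have ? : is_derive u 1 (fun v => (den p v)^-1) (den p u ^- 2 * ((1 - p) * expR (- u))).
  apply: (is_derive_eq (is_deriveV (d0 u) (is_derive_den p u))).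
  by rewrite /GRing.scale /=; ring.
rewrite /slope; apply: is_derive_eq.
by rewrite /ds /GRing.scale /=; field.
Qed.

Lemma hoeffding_bernoulli p t : 0 <= p <= 1 -> 0 <= t ->
  1 + p * (expR t - 1) <= expR (t * p + t ^+ 2 / 8).
Proof.
move=> p01 t0; have d0 u := den_gt0 u p01.
pose f u := u * p + u ^+ 2 / 8 - u - ln (den p u).
have f0 : f 0 = 0.
  by rewrite /f /den oppr0 expR0 mulr1 subrK ln1; ring.
have : f 0 <= f t.
  apply: (@ge0_derive_ge f (slope p) t _ _ t0) => u; last exact: slope_ge0.
  have ? : is_derive u 1 (fun v => ln (den p v))
      ((den p u)^-1 * (- ((1 - p) * expR (- u)))).
    have ? := is_derive_den p u; apply: (is_derive1_comp (f := @ln R) (g := den p)).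
    exact: is_derive1_ln.
  rewrite /f; apply: is_derive_eq.
  have du : (1 - p) * expR (- u) = den p u - p by rewrite /den addrK.
  rewrite du /slope /GRing.scale /=.
  by field; rewrite gt_eqF.
rewrite f0 /f => f_ge0.
have -> : 1 + p * (expR t - 1) = expR (t + ln (den p t)).
  rewrite expRD lnK ?posrE// /den [RHS]mulrDr (mulrCA (expR t)) -expRD subrr.
  by rewrite expR0; ring.
by rewrite ler_expR; lra.
Qed.

End HoeffdingLemma.

(** * Exponential moments of the score *)

Section ScoreMoments.
Context {R : realType} {I K : finType}.
Variable p : I -> K -> R.
Hypothesis p_ge0 : forall i k, 0 <= p i k.
Hypothesis p_sum1 : forall i, \sum_k p i k = 1.
Local Open Scope set_scope.
Implicit Types (x : {ffun I -> K}) (C : {set I}) (U : {set K}) (t : R).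

Lemma natr_cardE C x k :
  (#|C :&: label_class x k|)%:R = \sum_(i in C) (x i == k)%:R :> R.
Proof.
rewrite -sum1_card natr_sum big_mkcond [RHS]big_mkcond; apply: eq_bigr => i _ /=.
by rewrite !finset.inE; case: (i \in C); case: eqP.
Qed.

Let g t (k : K) C i l : R := if (i \in C) && (l == k) then expR t else 1.

Lemma expR_cardE t k C x :
  expR (t * (#|C :&: label_class x k|)%:R) =
  \prod_i (if (i \in C) && (x i == k) then expR t else 1).
Proof.
rewrite natr_cardE mulr_sumr expR_sum big_mkcond; apply: eq_bigr => i _.
by case: (i \in C); case: eqP => _ /=; rewrite ?mulr1 ?mulr0 ?expR0.
Qed.

Let sum_g t k C i : \sum_l p i l * g t k C i l =
  if i \in C then 1 + p i k * (expR t - 1) else 1.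
Proof.
rewrite /g; case: (i \in C) => /=; last first.
  by under eq_bigr do rewrite mulr1; exact: p_sum1.
rewrite (bigD1 k)//= eqxx -{2}(p_sum1 i) [in RHS](bigD1 k)//=.
rewrite (eq_bigr (p i)) => [|l /negbTE->]; last by rewrite mulr1.
by ring.
Qed.

Let a t x k C : R := expR (t * (#|C :&: label_class x k|)%:R) - 1.

(** Mean of [a t x k C] when [x] follows the product law. *)
Let abar t k C : R := \prod_(i in C) (1 + p i k * (expR t - 1)) - 1.

(* The blocks of [s] are disjoint and [h] does not involve them, so the factors
   split off one block at a time. *)
Lemma fE_potential t (s : seq {set I}) U (h : I -> K -> R) :
  pairwise (fun B C : {set I} => [disjoint B & C]%B) s ->
  (forall C i, C \in s -> i \in C -> forall l, h i l = 1) ->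
  fE p (fun x => (\prod_i h i (x i)) * potential (a t x) s U) =
  fE p (fun x => \prod_i h i (x i)) * potential (abar t) s U.
Proof.
elim: s U h => [|C s IH] U h /=.
  by move=> _ _; rewrite mulrC -fEZ; apply: eq_fE => x; rewrite mulrC.
move=> /andP[Cs ds] h1.
have h1s B i : B \in s -> i \in B -> forall l, h i l = 1.
  by move=> Bs; apply: h1; rewrite in_cons Bs orbT.
rewrite mulrDr -IH// mulr_sumr.
(* The exponential in [a t x k C] is absorbed into [h] as the factor [g t k C], which is 1 off [C]
   and hence on all remaining blocks; the induction hypothesis applies with and without it. *)
have step k : fE p (fun x => (\prod_i h i (x i)) * (a t x k C * potential (a t x) s (U :\ k))) =
    fE p (fun x => \prod_i h i (x i)) * (abar t k C * potential (abar t) s (U :\ k)).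
  transitivity (fE p (fun x => (\prod_i (h i (x i) * g t k C i (x i))) *
      potential (a t x) s (U :\ k)) -
    fE p (fun x => (\prod_i h i (x i)) * potential (a t x) s (U :\ k))).
    rewrite -fEB; apply: eq_fE => x.
    by rewrite big_split /= /a expR_cardE; ring.
  rewrite (IH _ (fun i l => h i l * g t k C i l))//; last first.
    move=> B i Bs iB l; rewrite (h1s B)// mul1r /g.
    by have /disjointFl-> := allP Cs _ Bs.
  rewrite IH// -mulrBl mulrA; congr (_ * _).
  rewrite (fE_prod p (fun i l => h i l * g t k C i l)) (fE_prod p h).
  rewrite /abar mulrBr mulr1; congr (_ - _).
  rewrite [X in _ * X]big_mkcond -big_split; apply: eq_bigr => i _ /=.
  rewrite -(sum_g t k C i); case: (boolP (i \in C)) => iC.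
    rewrite (eq_bigr (fun l => p i l * g t k C i l)) => [|l _]; last first.
      by rewrite (h1 C) ?mem_head// mul1r.
    rewrite (eq_bigr (p i) (F1 := fun l => p i l * h i l)) => [|l _].
      by rewrite p_sum1 mul1r.
    by rewrite (h1 C) ?mem_head// mulr1.
  rewrite (eq_bigr (fun l => p i l * h i l)) => [|l _]; last first.
    by rewrite /g (negbTE iC) mulr1.
  rewrite (eq_bigr (p i) (F1 := fun l => p i l * g t k C i l)) => [|l _].
    by rewrite p_sum1 mulr1.
  by rewrite /g (negbTE iC) mulr1.
rewrite -(eq_bigr _ (fun k _ => step k)) -fE_sum -fED.
by apply: eq_fE => x; rewrite mulrDr mulr_sumr.
Qed.

(** With [Q] the product over the tail, skipping the head block [C] costs at most [|U|! * Q], and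
    giving it to one of the [|U|] labels at most [|U| * (B C - 1) * (|U| - 1)! * Q]; for nonempty
    [U] the total is [|U|! * B C * Q]. *)
Lemma potential_le (b : K -> {set I} -> R) (B : {set I} -> R) s U :
  (forall k C, 0 <= b k C) -> (forall k C, C \in s -> b k C <= B C - 1) ->
  (forall C, C \in s -> 1 <= B C) ->
  potential b s U <= (#|U|)`!%:R * \prod_(C <- s) B C.
Proof.
move=> b0; elim: s U => [|C s IH] U /= bB B1; first by rewrite big_nil mulr1.
have bBs k D : D \in s -> b k D <= B D - 1.
  by move=> Ds; rewrite bB// in_cons Ds orbT.
have B1s D : D \in s -> 1 <= B D by move=> Ds; rewrite B1// in_cons Ds orbT.
have P0 : 0 <= \prod_(D <- s) B D.
  rewrite big_seq; apply: prodr_ge0 => D /B1s; exact: le_trans.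
set Q := \prod_(D <- s) B D in IH P0 *.
apply: (@le_trans _ _ ((#|U|)`!%:R * Q +
    \sum_(k in U) (B C - 1) * ((#|U|.-1)`!%:R * Q))).
  apply: lerD; first exact: IH.
  apply: ler_sum => k kU; apply: ler_pM; rewrite ?potential_ge0 ?bB ?mem_head//.
  by rewrite (le_trans (IH _ bBs B1s))// (cardsD1 k U) kU.
rewrite sumr_const big_cons -/Q.
case E : #|U| => [|m] /=.
  rewrite mulr0n addr0 fact0 !mul1r ler_peMl// B1// mem_head//.
by rewrite factS natrM -mulr_natl le_eqVlt; apply/orP; left; apply/eqP; ring.
Qed.

(* Up to the factor [#|K|!], the score has the Laplace transform of a sum of
   independent contributions, one per block. *)
Lemma fE_score_le t (c : {set {set I}}) (sigma : {ffun I -> K} -> K -> {set I})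
    (b : {set I} -> R) : 0 <= t -> finset.trivIset c ->
  (forall x, assignment c (sigma x)) ->
  (forall C, C \in c -> 0 <= b C) ->
  (forall k C, C \in c -> \prod_(i in C) (1 + p i k * (expR t - 1)) <= expR (b C)) ->
  t * fE p (fun x => (score x (sigma x))%:R) <= ln (#|K|)`!%:R + \sum_(C in c) b C.
Proof.
move=> t0 tc sc b0 pb; rewrite -fEZ; apply: fE_expR_le => //.
have a0 x k C : 0 <= a t x k C.
  by rewrite subr_ge0 -expR0 ler_expR mulr_ge0.
apply: (@le_trans _ _ (fE p (fun x => (\prod_(i : I) 1) *
    potential (a t x) (enum c) finset.setT))).
  apply: le_fE => // x; rewrite big1_eq mul1r.
  have [sc1 sc2] := sc x.
  apply: le_trans (prod_le_potential (sigma := sigma x) _ _ _ _) => //.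
  - rewrite /score natr_sum mulr_sumr expR_sum.
    rewrite [leRHS](eq_bigl predT) => [|k]; last by rewrite finset.inE.
    by rewrite le_eqVlt; apply/orP; left; apply/eqP; apply: eq_bigr => k _; rewrite /a addrC subrK.
  - by move=> k; rewrite /a finset.set0I cards0 mulr0 expR0 subrr.
  - move=> k _ k0; rewrite mem_enum; have := sc1 k.
    by rewrite !finset.inE (negbTE k0).
  - by move=> k l _ _; exact: sc2.
have dc : pairwise (fun B C : {set I} => [disjoint B & C]%B) (enum c).
  apply: (@sub_in_pairwise _ (mem c) [rel B C | B != C]).
  - by move=> B C Bc Cc; move/finset.trivIsetP: tc; exact.
  - by apply/allP => C; rewrite mem_enum.
  - by rewrite -uniq_pairwise enum_uniq.
rewrite (fE_potential t _ (h := fun _ _ => 1))//.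
under eq_fE do rewrite big1_eq.
rewrite fE_cst// mul1r.
apply: le_trans (potential_le (B := fun C => expR (b C)) _ _ _ _) _.
- move=> k C; rewrite subr_ge0.
  apply: (big_ind (fun y => 1 <= y)) => // [u v|i _]; first exact: mulr_ege1.
  by rewrite lerDl mulr_ge0// subr_ge0 -expR0 ler_expR.
- by move=> k C; rewrite mem_enum => Cc; rewrite lerD2r pb.
- by move=> C; rewrite mem_enum => Cc; rewrite -expR0 ler_expR b0.
rewrite cardsT expRD lnK ?posrE ?ltr0n ?fact_gt0// ler_wpM2l//.
by rewrite expR_sum big_enum.
Qed.

End ScoreMoments.

(** * Hoeffding and Poisson lower bounds on the expected loss *)

Section ScoreBounds.
Context {R : realType} {I K : finType}.
Variable p : I -> K -> R.
Hypothesis p_ge0 : forall i k, 0 <= p i k.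
Hypothesis p_sum1 : forall i, \sum_k p i k = 1.
Local Open Scope set_scope.
Variable c : {set {set I}}.
Hypothesis c_part : finset.partition c finset.setT.
Implicit Types (x : {ffun I -> K}) (C : {set I}) (t : R).

Lemma prob_le1 i k : p i k <= 1.
Proof. by rewrite -(p_sum1 i) (bigD1 k)//= lerDl sumr_ge0. Qed.

Lemma sum_blocks (F : I -> R) : \sum_(C in c) \sum_(i in C) F i = \sum_i F i.
Proof.
have /and3P[/eqP cT tc _] := c_part.
by rewrite -finset.big_trivIset//= cT; apply: eq_bigl => i; rewrite finset.inE.
Qed.

Definition mass k C : R := \sum_(i in C) p i k.

Lemma mass_ge0 k C : 0 <= mass k C.
Proof. by rewrite sumr_ge0. Qed.

Variable h : {set I} -> K.
Hypothesis h_max : forall k C, C \in c -> mass k C <= mass (h C) C.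

(* Expected number of errors of the classifier that labels each block by its
   most likely label. *)
Definition errors : R := \sum_(C in c) \sum_(i in C) (1 - p i (h C)).

Lemma errorsE : errors = #|I|%:R - \sum_(C in c) mass (h C) C.
Proof.
rewrite /errors; under eq_bigr do rewrite big_split /=.
rewrite big_split /= sum_blocks sumr_const; congr (_ + _).
by rewrite -sumrN; apply: eq_bigr => C _; rewrite sumrN.
Qed.

Lemma errors_ge0 : 0 <= errors.
Proof.
by apply: sumr_ge0 => C _; apply: sumr_ge0 => i _; rewrite subr_ge0 prob_le1.
Qed.

Variable sigma : {ffun I -> K} -> K -> {set I}.
Hypothesis sigmaP : forall x, assignment c (sigma x).

Let escore := fE p (fun x => (score x (sigma x))%:R).

Let c_triv : finset.trivIset c. Proof. by have /and3P[] := c_part. Qed.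

(** Hoeffding's lemma for each index bounds the transform on a block by an increasing function of
    [mass k C], so the worst label is [h C]. *)
Lemma escore_hoeffding t : 0 <= t ->
  t * escore <= ln (#|K|)`!%:R + t * (#|I|%:R - errors) + t ^+ 2 / 8 * #|I|%:R.
Proof.
move=> t0; have -> : ln (#|K|)`!%:R + t * (#|I|%:R - errors) + t ^+ 2 / 8 * #|I|%:R
    = ln (#|K|)`!%:R + \sum_(C in c) (t * mass (h C) C + \sum_(i in C) t ^+ 2 / 8).
  rewrite big_split /= sum_blocks sumr_const -mulr_sumr errorsE.
  by rewrite -[_ *+ #|I|]mulr_natr; ring.
apply: fE_score_le => // [C Cc|k C Cc].
  by rewrite addr_ge0// ?mulr_ge0 ?mass_ge0 ?sumr_ge0// => i _; rewrite divr_ge0 ?sqr_ge0.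
apply: (@le_trans _ _ (expR (t * mass k C + \sum_(i in C) t ^+ 2 / 8))); last first.
  by rewrite ler_expR lerD2r ler_wpM2l// h_max.
rewrite /mass mulr_sumr -big_split expR_sum; apply: ler_prod => i _ /=.
rewrite hoeffding_bernoulli ?p_ge0 ?prob_le1// andbT.
by rewrite addr_ge0// mulr_ge0// subr_ge0 -expR0 ler_expR.
Qed.

(** Each factor is [expR t * (1 - (1 - expR (- t)) * (1 - p i k))]. Applying [1 + y <= expR y] to
    the second part makes the correction proportional to the errors rather than to [#|I|]. *)
Lemma escore_poisson t : 0 <= t ->
  t * escore <= ln (#|K|)`!%:R + t * #|I|%:R - (1 - expR (- t)) * errors.
Proof.
move=> t0; have e1 : 0 <= 1 - expR (- t) by rewrite subr_ge0 -expR0 ler_expR oppr_le0.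
pose b k C : R := \sum_(i in C) (t - (1 - expR (- t)) * (1 - p i k)).
have -> : ln (#|K|)`!%:R + t * #|I|%:R - (1 - expR (- t)) * errors
    = ln (#|K|)`!%:R + \sum_(C in c) b (h C) C.
  rewrite -addrA; congr (_ + _).
  rewrite /b; under [RHS]eq_bigr do rewrite big_split /=.
  rewrite big_split /= sum_blocks sumr_const mulr_natr; congr (_ + _).
  rewrite /errors mulr_sumr -sumrN; apply: eq_bigr => C _.
  by rewrite mulr_sumr sumrN.
apply: fE_score_le => // [C Cc|k C Cc].
  apply: sumr_ge0 => i _; rewrite subr_ge0.
  apply: (@le_trans _ _ (1 - expR (- t))).
    by rewrite ler_piMr// lerBlDr lerDl.
  by rewrite lerBlDr -lerBlDl expR_ge1Dx.
apply: (@le_trans _ _ (expR (b k C))); last first.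
  rewrite ler_expR /b !sumrB lerD2l lerN2 -!mulr_sumr ler_wpM2l// !sumrB.
  by rewrite lerD2l lerN2 h_max.
rewrite /b expR_sum; apply: ler_prod => i _.
have -> : 1 + p i k * (expR t - 1) = expR t * (1 - (1 - expR (- t)) * (1 - p i k)).
  have : expR t * expR (- t) = 1 by rewrite -expRD subrr expR0.
  move=> e; transitivity (expR t - (expR t - expR t * expR (- t)) * (1 - p i k)).
    by rewrite e; ring.
  by ring.
have p1 := prob_le1 i k; rewrite expRD ler_wpM2l ?expR_ge0 ?expR_ge1Dx// andbT.
rewrite mulr_ge0 ?expR_ge0// subr_ge0.
apply: mulr_ile1 => //; rewrite ?subr_ge0// lerBlDr lerDl ?expR_ge0//.
Qed.

Let eloss := fE p (fun x => #|I|%:R - (score x (sigma x))%:R).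

Let elossE : eloss = #|I|%:R - escore.
Proof. by rewrite /eloss fEB fE_cst. Qed.

Lemma eloss_ge_hoeffding : (2 <= #|K|)%N -> (1 <= #|I|)%N ->
  errors - #|I|%:R * Num.sqrt (ln (#|K|)`!%:R / (2 * #|I|%:R)) <= eloss.
Proof.
move=> K2 I1; set l := ln _; set n := #|I|%:R; set e := Num.sqrt _.
have n0 : 0 < n by rewrite ltr0n.
have l0 : 0 < l.
  by rewrite ln_gt0// ltr1n (leq_trans K2)// fact_geq.
have e0 : 0 < e by rewrite sqrtr_gt0 divr_gt0 ?mulr_gt0.
have le : l = 2 * n * e ^+ 2.
  by rewrite sqr_sqrtr ?divr_ge0 ?mulr_ge0 ?ltW//; field; rewrite gt_eqF.
(* [4 * e] minimizes [l / t + t * n / 8], whose minimum is [n * e] since [l = 2 * n * e ^+ 2]. *)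
have := @escore_hoeffding (4 * e) (ltW (mulr_gt0 _ e0)); rewrite elossE -/l -/n.
rewrite le => /(_ (ltr0n _ _)) H.
rewrite -(ler_pM2l (mulr_gt0 (ltr0n R 4) e0)); nra.
Qed.

(** Take [t = xi] in [escore_poisson]. The second-order term of [1 - expR (- xi)] and the logarithm
    each cost at most [xi ^+ 2 / 2 * errors]. *)
Lemma eloss_ge_poisson (xi : R) : 0 < xi <= 1 ->
  2 * ln (#|K|)`!%:R <= xi ^+ 2 * errors -> (1 - xi) * errors <= eloss.
Proof.
move=> /andP[xi0 xi1] H; rewrite elossE -(ler_pM2l xi0).
have := escore_poisson (ltW xi0); set l := ln _ in H *.
(* It suffices that [(1 + xi + xi ^+ 2 / 2) * (1 - xi + xi ^+ 2 / 2) = 1 + xi ^+ 4 / 4] is at least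
   1. *)
have e2 : xi - xi ^+ 2 / 2 <= 1 - expR (- xi).
  have ex : 1 + xi + xi ^+ 2 / 2 <= expR xi.
    by rewrite expR_ge1DxD ?ltW.
  have : expR xi * expR (- xi) = 1 by rewrite -expRD subrr expR0.
  have := expR_gt0 (- xi); have := expR_gt0 xi.
  set u := expR xi in ex *; set v := expR (- xi).
  nra.
have := errors_ge0; set m := errors in H *.
nra.
Qed.

End ScoreBounds.
(** * Comparison with the largest block of each label *)

Section SwitchingBlocks.
Context {R : realType} {I K : finType}.
Local Open Scope set_scope.
Variable c : {set {set I}}.
Hypothesis c_part : finset.partition c finset.setT.
Variable h : {set I} -> K.
Implicit Types (x : {ffun I -> K}) (C : {set I}) (j k : K) (sigma : K -> {set I}).

Lemma block_disjoint C C' : C \in finset.set0 |: c -> C' \in finset.set0 |: c ->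
  C != C' -> [disjoint C & C']%B.
Proof.
have /and3P[_ /finset.trivIsetP tc _] := c_part.
rewrite !finset.inE => /orP[/eqP-> _ _|Cc /orP[/eqP-> _|C'c]].
- by rewrite finset.disjoints_subset finset.sub0set.
- by rewrite disjoint_sym finset.disjoints_subset finset.sub0set.
- exact: tc.
Qed.

Lemma sum_assignment_le sigma (F : {set I} -> nat) : assignment c sigma ->
  F finset.set0 = 0%N -> (\sum_k F (sigma k) <= \sum_(C in c) F C)%N.
Proof.
move=> [sc inj] F0.
apply: (@leq_trans (\sum_k \sum_(C in c | sigma k == C) F C)).
  apply: leq_sum => k _; have := sc k; rewrite !finset.inE => /orP[/eqP->|kc].
    by rewrite F0.
  by rewrite (bigD1 (sigma k)) ?leq_addr//= kc eqxx.
rewrite (exchange_big_dep (mem c)) /= => [|k C _ /andP[]//].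
apply: leq_sum => C Cc; rewrite (eq_bigl (fun k => sigma k == C)); last first.
  by move=> k; rewrite Cc.
have [->|/finset.set0Pn[i iC]] := eqVneq C finset.set0; first by rewrite F0 big1.
case: (pickP (fun k => sigma k == C)) => [k /eqP kC|none]; last first.
  by rewrite big_pred0.
rewrite (big_pred1 k)// => l /=; apply/eqP/eqP => [lC|->//].
by apply: inj; rewrite ?lC ?kC//; apply/finset.set0Pn; exists i.
Qed.

(** The reference assignment [tau], with which all other assignments are compared. *)
Definition rep k : {set I} :=
  if [pick C in c | h C == k] is Some C0
  then [arg max_(C > C0 in [set C in c | h C == k]) #|C|]%N else finset.set0.

Lemma rep_spec k : (rep k = finset.set0 /\ forall C, C \in c -> h C != k) \/
  [/\ rep k \in c, h (rep k) = k &
    forall C, C \in c -> h C = k -> (#|C| <= #|rep k|)%N].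
Proof.
rewrite /rep; case: pickP => [C0 C0k|none]; last first.
  by left; split => // C Cc; have := none C; rewrite Cc /= => ->.
right; case: arg_maxnP => [|C]; first by rewrite !finset.inE.
rewrite !finset.inE => /andP[Cc /eqP hC] Cmax; split => // C' C'c hC'.
by apply: Cmax; rewrite finset.inE C'c hC' eqxx.
Qed.

Lemma rep_in k : rep k \in finset.set0 |: c.
Proof.
by have [[-> _]|[kc _ _]] := rep_spec k; rewrite !finset.inE ?eqxx// kc orbT.
Qed.

Lemma rep_label k C : C \in c -> rep k = C -> h C = k.
Proof.
have /and3P[_ _ c0] := c_part.
by move=> Cc; have [[-> _] C0|[_ hk _ <-//]] := rep_spec k; move: c0; rewrite C0 Cc.
Qed.

(** A block can represent only its own label, so these are the blocks of [c] outside the range of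
    [rep]. *)
Definition unused : {set {set I}} := [set C in c | rep (h C) != C].

Lemma unused_rep j C : C \in unused -> rep j != C.
Proof.
rewrite finset.inE => /andP[Cc]; apply: contra_neq => jC.
by rewrite (rep_label Cc jC).
Qed.

Lemma sum_used (V : nmodType) (F : {set I} -> V) : F finset.set0 = 0 ->
  \sum_k F (rep k) + \sum_(C in unused) F C = \sum_(C in c) F C.
Proof.
move=> F0; rewrite [RHS](bigID (fun C => rep (h C) == C)) /=; congr (_ + _).
  rewrite (partition_big h predT)//=; apply: eq_bigr => k _.
  have [[k0 none]|[kc hk _]] := rep_spec k.
    by rewrite k0 F0 big1// => C /andP[/andP[/none/negbTE->]].
  rewrite (big_pred1 (rep k))// => C /=.
  apply/andP/eqP => [[/andP[_ /eqP CC] /eqP hC]|->]; first by rewrite -CC hC.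
  by rewrite kc hk !eqxx.
by apply: eq_bigl => C; rewrite finset.inE.
Qed.

Definition rep_size x j : nat := #|rep j :&: label_class x j|.

(** By [wrongE], this is the unnormalized loss [W] of the assignment [rep]. *)
Definition wrong x : nat := \sum_j #|label_class x j :\: rep j|.

Lemma sum_card_label_class x : (\sum_j #|label_class x j|)%N = #|I|.
Proof.
rewrite -sum1_card (partition_big x predT)//=; apply: eq_bigr => j _.
by rewrite -sum1_card; apply: eq_bigl => i; rewrite finset.inE.
Qed.

Lemma wrongE x : (wrong x + score x rep)%N = #|I|.
Proof.
rewrite /wrong /score -big_split /= -(sum_card_label_class x).
by apply: eq_bigr => j _; rewrite addnC finset.setIC cardsID.
Qed.

Lemma wrong_ge2 x j k : j != k ->
  (#|label_class x j| + #|label_class x k| <=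
   wrong x + rep_size x j + rep_size x k)%N.
Proof.
move=> jk; rewrite /wrong (bigD1 j)//= (bigD1 k) 1?eq_sym//= /rep_size.
rewrite -(cardsID (rep j) (label_class x j)) -(cardsID (rep k) (label_class x k)).
rewrite ![rep _ :&: _]finset.setIC; lia.
Qed.

Lemma card_block_le x j C : C \in finset.set0 |: c -> rep j != C ->
  (#|C :&: label_class x j| <= #|label_class x j :\: rep j|)%N.
Proof.
move=> Cc jC; apply/subset_leq_card/fintype.subsetP => i.
rewrite !finset.inE => /andP[iC ->]; rewrite andbT.
by have /disjointFl-> := block_disjoint (rep_in j) Cc jC.
Qed.

Definition gain x : nat :=
  \sum_(C in unused) \sum_j (#|C :&: label_class x j| - rep_size x j).

(** Let [A] be the set of labels moved by [sigma]. A single move profits by at most [gain x]. If [j]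
    and [k] both move, the moved labels collect at most [W] points in their new blocks and give up
    at least [N_j + N_k - W >= 2 * b - W], so the profit is at most [2 * (W - b)]. *)
Lemma score_le_gain x sigma (b : R) : assignment c sigma ->
  (forall j k, j != k -> 2 * b <= (#|label_class x j| + #|label_class x k|)%:R) ->
  (score x sigma)%:R <= (score x rep)%:R + (gain x)%:R
     + 2 * Num.max 0 ((wrong x)%:R - b).
Proof.
move=> [sc inj] good.
pose A := [set j | sigma j != rep j].
have AN j : j \notin A -> sigma j = rep j by rewrite finset.inE negbK => /eqP.
have scoreA : (score x sigma + \sum_(j in A) rep_size x j =
    score x rep + \sum_(j in A) #|sigma j :&: label_class x j|)%N.
  rewrite /score [X in (X + _)%N](bigID (mem A)) [X in _ = (X + _)%N](bigID (mem A)) /=.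
  rewrite (eq_bigr (fun j => #|rep j :&: label_class x j|) (P := fun j => j \notin A)).
    by rewrite /rep_size; lia.
  by move=> j /AN->.
have max0 : 0 <= 2 * Num.max 0 ((wrong x)%:R - b).
  by rewrite mulr_ge0// le_max lexx.
case: (leqP #|A| 1) => [A1|].
  have : (score x sigma <= score x rep + gain x)%N.
    case: (pickP (fun j => j \in A)) => [j jA|A0]; last first.
      move: scoreA; rewrite !big_pred0//; lia.
    have Aj : A = [set j].
      by apply/eqP; rewrite eq_sym eqEcard finset.sub1set jA cards1.
    move: scoreA; rewrite Aj !big_set1 => scoreA.
    suff : (#|sigma j :&: label_class x j| - rep_size x j <= gain x)%N by lia.
    have := sc j; rewrite !finset.inE => /orP[/eqP->|jc]; first by rewrite finset.set0I cards0.
    (* A nonempty block represents at most the label [h (sigma j)]. That label either is [j], which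
       has left its representative, or has not moved and would share its block with [j]. *)
    have jT : sigma j \in unused.
      rewrite finset.inE jc /=; apply/eqP => E.
      have [kA|/AN kA] := boolP (h (sigma j) \in A).
        by move: kA; rewrite Aj finset.inE => /eqP kj; move: jA; rewrite finset.inE -E kj eqxx.
      have kj : h (sigma j) = j.
        apply: inj; rewrite kA// E; apply: contraTneq jc => ->.
        by have /and3P[] := c_part.
      by move: jA; rewrite finset.inE -E kj eqxx.
    rewrite /gain (bigD1 (sigma j))//= (bigD1 j)//= -addnA; exact: leq_addr.
  rewrite -(ler_nat R) natrD => H; apply: le_trans H _; rewrite lerDl//.
case/card_gt1P => j [k [jA kA jk]].
have W : (\sum_(j in A) #|sigma j :&: label_class x j| <= wrong x)%N.
  rewrite /wrong [leqRHS](bigID (mem A)) /=; apply: leq_trans (leq_addr _ _).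
  apply: leq_sum => l; rewrite finset.inE => lA; apply: card_block_le; first exact: sc.
  by rewrite eq_sym.
have V : (rep_size x j + rep_size x k <= \sum_(j in A) rep_size x j)%N.
  by rewrite (bigD1 j)//= (bigD1 k) ?leq_add2l ?leq_addr//= kA eq_sym.
have W2 := wrong_ge2 x jk; have G := good j k jk.
have : (score x sigma + (#|label_class x j| + #|label_class x k|) <=
  score x rep + wrong x + wrong x)%N by lia.
rewrite -(ler_nat R) !natrD => H.
have : (wrong x)%:R - b <= Num.max 0 ((wrong x)%:R - b) by rewrite le_max lexx orbT.
move: G; rewrite natrD => G.
have := ler0n R (gain x); lra.
Qed.

Lemma rep_size_unique x C j k (b : R) : C \in unused -> j != k ->
  2 * b <= (#|label_class x j| + #|label_class x k|)%:R ->
  (rep_size x j <= #|C :&: label_class x j|)%N ->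
  (rep_size x k <= #|C :&: label_class x k|)%N -> b <= (wrong x)%:R.
Proof.
move=> CT jk G jC kC.
have Cc : C \in finset.set0 |: c.
  by move: CT; rewrite !finset.inE => /andP[-> _]; rewrite orbT.
have := wrong_ge2 x jk.
have := card_block_le x Cc (unused_rep j CT).
have := card_block_le x Cc (unused_rep k CT).
have : (#|label_class x j :\: rep j| + #|label_class x k :\: rep k| <= wrong x)%N.
  by rewrite /wrong (bigD1 j)//= (bigD1 k) 1?eq_sym//= addnA leq_addr.
move=> H1 H2 H3 H4.
have : (#|label_class x j| + #|label_class x k| <= wrong x + wrong x)%N by lia.
rewrite -(ler_nat R) [in leRHS]natrD => H5.
by move: (le_trans G H5); lra.
Qed.

Definition mislabelled x : nat := \sum_(C in c) #|C :\: label_class x (h C)|.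

(** A label holding a block that the classifier gives to it scores at most the size of its largest
    such block; a label holding any other block scores only points mislabelled there. *)
Lemma score_le_mislabelled x sigma : assignment c sigma ->
  (score x sigma <= \sum_k #|rep k| + mislabelled x)%N.
Proof.
move=> sP; have [sc inj] := sP.
apply: (@leq_trans (\sum_k (#|rep k| +
    #|sigma k :\: label_class x (h (sigma k))|)))%N; last first.
  rewrite big_split leq_add2l /=.
  by apply: (sum_assignment_le (F := fun C => #|C :\: label_class x (h C)|)) => //;
    rewrite finset.set0D cards0.
apply: leq_sum => k _; have := sc k; rewrite !finset.inE => /orP[/eqP->|kc].
  by rewrite finset.set0I cards0.
have [hk|hk] := eqVneq (h (sigma k)) k.
  apply: leq_trans (leq_addr _ _).
  apply: (@leq_trans #|sigma k|); first by rewrite subset_leq_card// finset.subsetIl.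
  have [[_ none]|[_ _ kmax]] := rep_spec k; last exact: kmax.
  by have := none _ kc; rewrite hk eqxx.
apply: leq_trans (leq_addl _ _); apply/subset_leq_card/fintype.subsetP => i.
rewrite !finset.inE => /andP[-> /eqP->]; rewrite andbT.
by rewrite eq_sym.
Qed.

End SwitchingBlocks.

Section GainExpectation.
Context {R : realType} {I K : finType}.
Variable p : I -> K -> R.
Hypothesis p_ge0 : forall i k, 0 <= p i k.
Hypothesis p_sum1 : forall i, \sum_k p i k = 1.
Local Open Scope set_scope.
Variable c : {set {set I}}.
Hypothesis c_part : finset.partition c finset.setT.
Variable h : {set I} -> K.
Hypothesis h_max : forall k C, C \in c -> mass p k C <= mass p (h C) C.
Implicit Types (x : {ffun I -> K}) (C : {set I}) (j k : K).

Local Notation rep := (rep c h).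
Local Notation rep_size := (rep_size c h).
Local Notation unused := (unused c h).
Local Notation wrong := (wrong c h).
Local Notation errors := (errors p c h).
Local Notation mass := (mass p).

Lemma fE_card C j : fE p (fun x => (#|C :&: label_class x j|)%:R) = mass j C.
Proof.
under eq_fE do rewrite natr_cardE.
by rewrite fE_sum; apply: eq_bigr => i _; rewrite fE_ind.
Qed.

Lemma sum_mass C : \sum_j mass j C = (#|C|)%:R.
Proof.
rewrite exchange_big -sum1_card natr_sum; apply: eq_bigr => i _.
exact: p_sum1.
Qed.

Lemma card_resample C x i j : i \in C ->
  (#|C :&: label_class (resample x i j) j| <= #|C :&: label_class x j|.+1)%N.
Proof.
move=> iC; rewrite -add1n -(cards1 i).
apply: leq_trans (leq_card_setU _ _); apply/subset_leq_card/fintype.subsetP => l.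
by rewrite !finset.inE !ffunE; case: (l == i).
Qed.

Lemma card_resample_out C x i j : i \notin C ->
  #|C :&: label_class (resample x i j) j| = #|C :&: label_class x j|.
Proof.
move=> iC; apply: eq_card => l; rewrite !finset.inE !ffunE.
by have [->|] := eqVneq l i; rewrite ?(negbTE iC).
Qed.

(* Leave-one-out: conditionally on [x i = j], the block count may exceed the
   count of the representative only if it was at least as large before. *)
Lemma fE_excess C j : C \in unused ->
  fE p (fun x => (#|C :&: label_class x j| - rep_size x j)%N%:R) <=
  mass j C * fE p (fun x => (rep_size x j <= #|C :&: label_class x j|)%N%:R).
Proof.
move=> CT.
pose G x : R := (rep_size x j < #|C :&: label_class x j|)%N%:R.
apply: (@le_trans _ _ (fE p (fun x => \sum_(i in C) ((x i == j)%:R * G x)))).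
  apply: le_fE => // x; rewrite -mulr_suml -natr_cardE /G.
  case: ltnP => [_|]; first by rewrite mulr1 ler_nat leq_subr.
  by rewrite -subn_eq0 => /eqP->; rewrite mulr0.
rewrite fE_sum /mass mulr_suml; apply: ler_sum => i iC.
rewrite (fE_ind_mul p_sum1 i j G) ler_wpM2l//; apply: le_fE => // x.
rewrite /G ler_nat.
have irep : i \notin rep j.
  have Cc : C \in finset.set0 |: c.
    by move: CT; rewrite !finset.inE => /andP[-> _]; rewrite orbT.
  have := block_disjoint c_part (rep_in c h j) Cc (unused_rep c_part j CT).
  by move=> /disjointFl->.
have := card_resample x j iC; rewrite /rep_size (card_resample_out x j irep).
move=> le; case: ltnP => // lt; rewrite lt0b -ltnS.
exact: leq_trans lt le.
Qed.

Variable a : R.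

Definition balanced x : bool :=
  [forall j, forall k, (j != k) ==>
    (2 * a <= (#|label_class x j| + #|label_class x k|)%:R)].

Lemma balancedP x j k : balanced x -> j != k ->
  2 * a <= (#|label_class x j| + #|label_class x k|)%:R.
Proof. by move=> /forallP/(_ j)/forallP/(_ k)/implyP. Qed.

Lemma sum_rep_unused :
  (\sum_k #|rep k| + \sum_(C in unused) #|C| = #|I|)%N.
Proof.
rewrite -cardsT (card_partition c_part).
exact: (sum_used c h (V := nat) (F := fun C => #|C|) (cards0 _)).
Qed.

Lemma fE_gain_le :
  fE p (fun x => (gain c h x)%:R) <= \sum_(C in unused) mass (h C) C +
    (\sum_(C in unused) #|C|)%:R *
      fE p (fun x => (~~ (balanced x && ((wrong x)%:R < a)))%:R).
Proof.
set bad := fE p (fun x => (~~ _)%:R).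
rewrite natr_sum mulr_suml -big_split /= /gain.
under eq_fE do rewrite natr_sum.
rewrite fE_sum; apply: ler_sum => C CT.
under eq_fE do rewrite natr_sum.
rewrite fE_sum; apply: le_trans (ler_sum _ (fun j _ => fE_excess j CT)) _.
under eq_bigr do rewrite -fEZ.
rewrite -fE_sum /bad -fEZ -(fE_cst p_sum1 (mass (h C) C)) -fED.
apply: le_fE => // x.
have Cc : C \in c by move: CT; rewrite finset.inE => /andP[].
case: (boolP (balanced x && _)) => [/andP[bx wx]|_] /=.
  rewrite mulr0 addr0.
  case: (pickP (fun j => rep_size x j <= #|C :&: label_class x j|)%N) => [j jC|none].
    rewrite (bigD1 j)//= jC mulr1 big1 ?addr0 ?h_max// => k kj.
    case: leqP => kC; last by rewrite mulr0.
    have := rep_size_unique c_part CT kj (balancedP bx kj) kC jC.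
    by rewrite leNgt wx.
  by rewrite big1 ?mass_ge0// => j _; rewrite none mulr0.
rewrite mulr1 -sum_mass -[leLHS]add0r; apply: lerD; first exact: mass_ge0.
by apply: ler_sum => j _; rewrite ler_piMr ?mass_ge0// lern1 leq_b1.
Qed.

Lemma fE_wrong : fE p (fun x => (wrong x)%:R) =
  errors + \sum_(C in unused) mass (h C) C.
Proof.
transitivity (#|I|%:R - fE p (fun x => (score x rep)%:R)).
  rewrite -{1}(fE_cst p_sum1 (#|I|%:R : R)) -fEB; apply: eq_fE => x.
  by rewrite -(wrongE c h x) natrD addrK.
have -> : fE p (fun x => (score x rep)%:R) = \sum_k mass (h (rep k)) (rep k).
  rewrite /score; under eq_fE do rewrite natr_sum.
  rewrite fE_sum; apply: eq_bigr => k _; rewrite fE_card.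
  have [[-> _]|[_ -> _]//] := rep_spec c h k.
  by rewrite /mass !big_set0.
rewrite (errorsE p c_part) -(sum_used c h (F := fun C => mass (h C) C)).
  by ring.
by rewrite /mass big_set0.
Qed.

Lemma fE_mislabelled : fE p (fun x => (mislabelled c h x)%:R) = errors.
Proof.
rewrite /mislabelled; under eq_fE do rewrite natr_sum.
rewrite fE_sum; apply: eq_bigr => C _.
transitivity (fE p (fun x => (#|C|)%:R - (#|C :&: label_class x (h C)|)%:R)).
  by apply: eq_fE => x; rewrite -(cardsID (label_class x (h C)) C) natrD addrC addKr.
by rewrite fEB fE_cst// fE_card /mass sumrB -sum1_card natr_sum.
Qed.

Variable sigma : {ffun I -> K} -> K -> {set I}.
Hypothesis sigmaP : forall x, assignment c (sigma x).

Let eloss := fE p (fun x => #|I|%:R - (score x (sigma x))%:R).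

Lemma eloss_ge_unused : (\sum_(C in unused) #|C|)%:R - errors <= eloss.
Proof.
rewrite -fE_mislabelled -(fE_cst p_sum1 (\sum_(C in unused) #|C|)%N%:R) -fEB.
apply: le_fE => // x; have := score_le_mislabelled h x (sigmaP x).
rewrite -sum_rep_unused -(ler_nat R) !natrD; lra.
Qed.

Lemma eloss_ge_wrong :
  errors - fE p (fun x => (\sum_(C in unused) #|C|)%:R * (a <= (wrong x)%:R)%R%:R +
      2 * Num.max 0 ((wrong x)%:R - a))
    - 2 * #|I|%:R * fE p (fun x => (~~ balanced x)%:R) <= eloss.
Proof.
set t := (\sum_(C in unused) #|C|)%:R.
pose tail x : R := 2 * Num.max 0 ((wrong x)%:R - a).
have t0 : 0 <= t by rewrite ler0n.
have tn : t <= #|I|%:R by rewrite ler_nat -sum_rep_unused leq_addl.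
have gainle := fE_gain_le; rewrite -/t in gainle.
have le1 : fE p (fun x => (wrong x)%:R - (gain c h x)%:R - tail x
     - #|I|%:R * (~~ balanced x)%:R) <= eloss.
  apply: le_fE => // x.
  have tail0 : 0 <= tail x by rewrite mulr_ge0// le_max lexx.
  have gain0 := ler0n R (gain c h x).
  have := wrongE c h x; move/(congr1 (fun m => m%:R : R)); rewrite natrD => nW.
  have [bx|bx] := boolP (balanced x).
    have := score_le_gain c_part h (sigmaP x) (fun j k => balancedP bx).
    by rewrite /= -/(tail x) mulr0; lra.
  have sn : (score x (sigma x))%:R <= #|I|%:R :> R.
    rewrite ler_nat -[leqRHS]cardsT (card_partition c_part).
    apply: leq_trans (sum_assignment_le (F := fun C => #|C| : nat) (sigmaP x) (cards0 _)).
    by apply: leq_sum => k _; rewrite subset_leq_card// finset.subsetIl.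
  by rewrite /= mulr1; have := ler0n R (score x rep); lra.
have le2 : fE p (fun x => (~~ (balanced x && ((wrong x)%:R < a)))%:R) <=
    fE p (fun x => (a <= (wrong x)%:R)%R%:R) + fE p (fun x => (~~ balanced x)%:R).
  rewrite -fED; apply: le_fE => // x; rewrite negb_and -leNgt -natrD ler_nat.
  by case: (balanced x); case: (_ <= _).
have bad0 : 0 <= fE p (fun x => (~~ balanced x)%:R) by apply: fE_ge0.
move: le1; rewrite !fEB !fEZ fE_wrong fED !fEZ -/(tail _) => le1.
have := ler_wpM2l t0 le2; have := ler_wpM2r bad0 tn.
lra.
Qed.

(** [W] is the sum of the independent indicators of [i \notin rep (x i)], and [1 + y <= expR y]
    bounds each factor. *)
Lemma fE_expR_wrong (s : R) : 0 <= s ->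
  fE p (fun x => expR (s * (wrong x)%:R)) <=
  expR ((expR s - 1) * fE p (fun x => (wrong x)%:R)).
Proof.
move=> s0.
have wrong_sum x : (wrong x)%:R = \sum_i (i \notin rep (x i))%:R :> R.
  rewrite -natr_sum; congr (_%:R); rewrite /wrong.
  rewrite (eq_bigr (fun j => \sum_i ((x i == j) && (i \notin rep j)))%N); last first.
    move=> j _; rewrite -sum1_card big_mkcond; apply: eq_bigr => i _ /=.
    by rewrite !finset.inE andbC; case: (_ && _).
  rewrite exchange_big; apply: eq_bigr => i _ /=.
  by rewrite (bigD1 (x i))//= eqxx big1 ?addn0// => j; rewrite eq_sym => /negbTE->.
rewrite (eq_fE p (F := fun x => expR _)
  (G := fun x => \prod_i expR (s * (i \notin rep (x i))%:R))); last first.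
  by move=> x; rewrite wrong_sum mulr_sumr expR_sum.
rewrite (fE_prod p (fun i k => expR (s * (i \notin rep k)%:R))).
under eq_fE do rewrite wrong_sum.
rewrite fE_sum mulr_sumr expR_sum; apply: ler_prod => i _.
rewrite sumr_ge0 => [|k _]; last by rewrite mulr_ge0 ?expR_ge0.
rewrite (fE_coord p_sum1 i (fun k => (i \notin rep k)%:R)).
apply: le_trans (expR_ge1Dx _).
rewrite le_eqVlt; apply/orP; left; rewrite mulr_sumr -[X in X + _](p_sum1 i) -big_split.
apply/eqP; apply: eq_bigr => k _ /=.
by case: (i \notin _); rewrite ?mulr1 ?mulr0 ?expR0; ring.
Qed.

End GainExpectation.

(** * The regime of small Bayes risk *)

Section CrudeRegime.
Context {R : realType}.

Lemma expR1_ge2 : 2 <= expR 1 :> R.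
Proof. by have := expR_ge1Dx (1 : R); lra. Qed.

(** Here [z * a = 3 * m] bounds the mean of [W], [a] is the threshold, and
    [expR (a * (1 - z + ln z))] is the Chernoff bound for exceeding it. Since [a = n * b / 4], the
    exponent in [xi] is [1 - 1 / a]. *)
Lemma crude_regime_bound (n l b m : R) :
  let a := n * b / 4 in let z := 3 * m / a in
  let xi := 4 * expR 1 / b * Num.sqrt (l / (2 * n)) `^ (1 - 4 / (n * b)) in
  0 < n -> 2^-1 <= l -> 0 < b <= 1 -> 1 < a -> 0 < m ->
  xi < 1 -> xi ^+ 2 * m < 2 * l ->
  ln z <= - 2^-1 /\ (2 * m + 4) * expR (a * (1 - z + ln z)) <= xi * m.
Proof.
move=> a z; set eps := Num.sqrt _; move=> xi n0 l2 /andP[b0 b1] a1 m0 xi1 xim.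
have a0 : 0 < a by lra.
have l0 : 0 < l by lra.
have z0 : 0 < z by rewrite divr_gt0 ?mulr_gt0.
have eps0 : 0 < eps by rewrite sqrtr_gt0 divr_gt0 ?mulr_gt0.
have eps2 : 2 * n * eps ^+ 2 = l.
  by rewrite sqr_sqrtr ?divr_ge0 ?mulr_ge0 ?ltW//; field; rewrite gt_eqF.
(* Logarithmic scale: the power of [eps] in [xi] is [expR H], and [eps] itself is [expR (H + D)]. *)
pose D := ln eps / a; pose H := (a - 1) * D.
have etaE : eps `^ (1 - 4 / (n * b)) = expR H.
  rewrite /powR gt_eqF//; congr expR; rewrite /H /D /a.
  by field; rewrite !gt_eqF.
have epsE : eps = expR (H + D).
  rewrite -[LHS]lnK ?posrE//; congr expR; rewrite /H /D.
  by field; rewrite gt_eqF.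
have xiE : b * xi = 4 * expR (1 + H).
  by rewrite /xi etaE expRD; field; rewrite gt_eqF.
have mE : 12 * m = z * n * b.
  by rewrite /z /a; field; rewrite !gt_eqF.
have eta4 : 4 * expR (1 + H) < b by rewrite -xiE gtr_pMr.
have H1 : H + 1 < 0.
  rewrite -ltrBrDr sub0r -ltr_expR -(ltr_pM2l (ltr0n R 4)) ?ltr0n//.
  have := expR_gt0 (-1 : R); rewrite addrC expRD in eta4.
  have e1 : expR 1 * expR (-1) = 1 :> R by rewrite -expRD subrr expR0.
  have := expR1_ge2; have := expR_gt0 H.
  set y := expR H in eta4 *; set e := expR 1 in eta4 e1 *; set f := expR (-1) in e1 *.
  nra.
have D0 : D < 0 by rewrite -(pmulr_rlt0 _ (_ : 0 < a - 1)) ?subr_gt0//; rewrite -/H; lra.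
(* [eps < expR H < 1 / 8] while [eps ^+ 2 = l / (2 * n) >= 1 / (4 * n)]. The value 12 absorbs the
   factor [n / 12] of [xim2]. *)
have n12 : 12 <= n.
  have eH : 8 * expR H < 1.
    by move: eta4; rewrite expRD; have := expR1_ge2; have := expR_gt0 H; nra.
  have : 64 * eps ^+ 2 < 1.
    have : eps < expR H by rewrite epsE ltr_expR; lra.
    by nra.
  by nra.
(* This is the hypothesis [xi ^+ 2 * m < 2 * l] multiplied by [b ^+ 2], with [xi], [m] and [l]
   replaced through [xiE], [mE] and [eps2]. *)
have zlt : z * expR (2 * (1 + H)) < 3 * b * expR (2 * (H + D)).
  have sqE (y : R) : expR (2 * y) = expR y ^+ 2 by rewrite -expRM_natl.
  rewrite !sqE -epsE.
  have : b ^+ 2 * (xi ^+ 2 * m) < b ^+ 2 * (2 * l) by rewrite ltr_pM2l ?exprn_gt0.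
  rewrite mulrA -exprMn xiE -eps2.
  set y := expR (1 + H); move=> H2.
  have mzn : m = z * n * b / 12 by lra.
  have H3 : (n * b) * (z * y ^+ 2) < (n * b) * (3 * b * eps ^+ 2).
    by move: H2; rewrite mzn; lra.
  by move: H3; rewrite ltr_pM2l ?mulr_gt0.
(* In logarithms the terms [2 * H] cancel. *)
have u_le : ln z <= ln 3 + ln b + 2 * D - 2.
  have -> : ln 3 + ln b + 2 * D - 2 = ln (3 * b * expR (2 * D) / expR 2).
    by rewrite ln_div ?lnM ?posrE ?mulr_gt0 ?expR_gt0// !expRK.
  rewrite ler_ln ?posrE ?divr_gt0 ?mulr_gt0 ?expR_gt0// ler_pdivlMr ?expR_gt0//.
  rewrite -(ler_pM2r (expR_gt0 (2 * H))).
  by move: zlt; rewrite !mulrDr mulr1 !expRD; lra.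
have lnb0 : ln b <= 0 by rewrite ln_le0.
have ln3 : ln 3 <= 3 / 2 :> R.
  rewrite -[leRHS]expRK ler_ln ?posrE ?expR_gt0//.
  apply: le_trans (expR_ge1DxD _) => //; lra.
have lnz : ln z <= - 2^-1 by lra.
split=> //.
have z34 : z <= 3 / 4.
  rewrite -[z]lnK ?posrE//; have : expR (ln z) * expR 2^-1 <= 1.
    by rewrite -expRD -[leRHS]expR0 ler_expR; lra.
  have : 1 + 2^-1 <= expR 2^-1 :> R := expR_ge1Dx _.
  have := expR_gt0 (ln z); nra.
(* From [ln (3 * z) <= 3 * z - 1], which is at most [5 * z / 3] exactly when [z <= 3 / 4]. *)
have ln3z : ln 3 + ln z <= 5 * z / 3.
  rewrite -lnM ?posrE//; have z3 : 0 < 3 * z by rewrite pmulr_rgt0.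
  have := expR_ge1Dx (ln (3 * z)); rewrite lnK ?posrE//.
  lra.
have m4 : 2 * m + 4 <= 4 * expR (z * a / 6).
  have -> : z * a / 6 = m / 2 by rewrite /z divfK ?gt_eqF//; lra.
  by have := expR_ge1Dx (m / 2); lra.
have xim2 : xi * m = 4 * expR (1 + H + ln z) * (n / 12).
  rewrite expRD lnK ?posrE//; have -> : m = z * n * b / 12 by lra.
  rewrite -[RHS](mulrA 4) mulrC.
  by transitivity ((b * xi) * (z * n / 12)); [ring|rewrite xiE; ring].
apply: le_trans (ler_wpM2r (expR_ge0 _) m4) _.
rewrite xim2 -[leLHS]mulrA -expRD.
apply: (@le_trans _ _ (4 * expR (1 + H + ln z))); last first.
  by rewrite ler_peMr ?mulr_ge0 ?expR_ge0// ler_pdivlMr// mul1r.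
(* By [u_le] and [lnb0], [D >= (ln z - ln 3 + 2) / 2]; the comparison of exponents reduces to [(a -
   1) * (ln 3 + ln z) / 2 <= 5 * a * z / 6], which follows from [ln3z]. *)
rewrite ler_pM2l// ler_expR /H; nra.
Qed.

End CrudeRegime.

(** * Combination of the three regimes into the multiplicative bound *)

Section FastBound.
Context {R : realType} {I K : finType}.
Variable p : I -> K -> R.
Hypothesis p_ge0 : forall i k, 0 <= p i k.
Hypothesis p_sum1 : forall i, \sum_k p i k = 1.
Variable c : {set {set I}}.
Hypothesis c_part : finset.partition c finset.setT.
Variable h : {set I} -> K.
Hypothesis h_max : forall k C, C \in c -> mass p k C <= mass p (h C) C.
Variable sigma : {ffun I -> K} -> K -> {set I}.
Hypothesis sigmaP : forall x, assignment c (sigma x).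
Hypotheses (K_ge2 : (2 <= #|K|)%N) (I_ge1 : (1 <= #|I|)%N).

Let eloss := fE p (fun x => #|I|%:R - (score x (sigma x))%:R).
Let errors := errors p c h.

Lemma ln_fact_ge : 2^-1 <= ln (#|K|)`!%:R :> R.
Proof.
have : 2 <= (#|K|)`!%:R :> R by rewrite (ler_nat R 2) (leq_trans K_ge2)// fact_geq.
move=> K2; have f0 : 0 < (#|K|)`!%:R :> R by lra.
have : expR (- ln (#|K|)`!%:R) <= 2^-1 :> R.
  by rewrite -lnV ?posrE// lnK ?posrE ?invr_gt0// lef_pV2 ?posrE.
have := expR_ge1Dx (- ln (#|K|)`!%:R : R); lra.
Qed.

(** Exponential Markov inequality at [expR s = z^-1], the optimal choice for mean [z * a]. For
    [u = W - a >= 0], [s >= 1 / 2] gives [2 * u <= 4 * s * u <= 4 * (expR (s * u) - 1)], so the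
    linear excess costs only the constant 4. The mean of [W] is at most
    [errors + t <= 3 * errors]. *)
Lemma wrong_tail_le (a : R) :
  let z := 3 * errors / a in let t := (\sum_(C in unused c h) #|C|)%:R in
  0 < a -> 0 < errors -> t <= 2 * errors -> ln z <= - 2^-1 ->
  fE p (fun x => t * (a <= (wrong c h x)%:R)%R%:R +
    2 * Num.max 0 ((wrong c h x)%:R - a)) <=
  (2 * errors + 4) * expR (a * (1 - z + ln z)).
Proof.
move=> z t a0 m0 t2m lnz; pose s := - ln z; pose w x : R := (wrong c h x)%:R.
have z0 : 0 < z by rewrite divr_gt0 ?mulr_gt0.
have s2 : 2^-1 <= s by rewrite /s; lra.
have es : expR s = z^-1 by rewrite expRN lnK ?posrE.
have t0 : 0 <= t by rewrite ler0n.
apply: (@le_trans _ _ (fE p (fun x => (2 * errors + 4) * expR (- (s * a)) * expR (s * w x)))).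
  apply: le_fE => // x; rewrite -mulrA -expRD -/(w x).
  have -> : - (s * a) + s * w x = s * (w x - a) by ring.
  have [aw|wa] := leP a (w x); last first.
    rewrite mulr0 add0r; have -> : Num.max 0 (w x - a) = 0.
      by apply/max_idPl; rewrite subr_le0 ltW.
    by rewrite mulr0 mulr_ge0 ?expR_ge0//; lra.
  have -> : Num.max 0 (w x - a) = w x - a by apply/max_idPr; rewrite subr_ge0.
  set u := w x - a; have u0 : 0 <= u by rewrite subr_ge0.
  have := expR_ge1Dx (s * u); set e := expR _ => e1.
  have su : 2^-1 * u <= s * u by rewrite ler_wpM2r.
  have : 0 <= errors * (e - 1) by rewrite mulr_ge0 ?(ltW m0)//; lra.
  by rewrite mulr1; lra.
rewrite fEZ -mulrA; apply: ler_wpM2l; first by lra.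
apply: le_trans (ler_wpM2l (expR_ge0 _) (fE_expR_wrong p_ge0 p_sum1 c h _)) _.
  by lra.
rewrite -expRD ler_expR es.
have wm : fE p (fun x => (wrong c h x)%:R) <= 3 * errors.
  rewrite (fE_wrong p_sum1 c_part) -/errors.
  suff : \sum_(C in unused c h) mass p (h C) C <= t by lra.
  rewrite /t natr_sum; apply: ler_sum => C _.
  rewrite -(sum_mass p_sum1) (bigD1 (h C))//= lerDl.
  by apply: sumr_ge0 => k _; exact: mass_ge0.
have z1 : 1 <= z^-1 by rewrite -es -expR0 ler_expR; lra.
have := ler_wpM2l (_ : 0 <= z^-1 - 1) wm; rewrite subr_ge0 => /(_ z1).
have -> : (z^-1 - 1) * (3 * errors) = a - z * a.
  have -> : 3 * errors = z * a by rewrite /z divfK ?gt_eqF.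
  by rewrite mulrBl mul1r mulKf// gt_eqF.
rewrite /s; lra.
Qed.

Lemma eloss_ge_fast (b : R) :
  let n := #|I|%:R in let a := n * b / 4 in
  let xi := 4 * expR 1 / b *
    Num.sqrt (ln (#|K|)`!%:R / (2 * n)) `^ (1 - 4 / (n * b)) in
  0 < b <= 1 -> 1 < a -> xi < 1 ->
  (1 - xi) * errors - 2 * n * fE p (fun x => (~~ balanced a x)%:R) <= eloss.
Proof.
move=> n a xi b01 a1 xi1; set bad := fE p _.
have n0 : 0 < n by rewrite ltr0n.
have bad0 : 0 <= 2 * n * bad by rewrite mulr_ge0 ?fE_ge0// mulr_ge0 ?ltW.
have l2 := ln_fact_ge.
have xi0 : 0 < xi.
  case/andP: b01 => b0 _; rewrite mulr_gt0 ?divr_gt0 ?mulr_gt0 ?expR_gt0// powR_gt0//.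
  by rewrite sqrtr_gt0 divr_gt0 ?mulr_gt0//; lra.
have m0 : 0 <= errors by apply: errors_ge0.
have xim : 0 <= xi * errors by rewrite mulr_ge0// ltW.
have [H|H] := leP (2 * ln (#|K|)`!%:R) (xi ^+ 2 * errors).
  have xi01 : 0 < xi <= 1 by rewrite xi0 ltW.
  have := eloss_ge_poisson p_ge0 p_sum1 c_part h_max sigmaP xi01 H.
  by rewrite -/eloss -/errors; lra.
have := eloss_ge_unused p_ge0 p_sum1 c_part h sigmaP; rewrite -/eloss -/errors => crude.
set t := (\sum_(C in _) _)%:R in crude.
have [t2m|t2m] := leP (2 * errors) t; first by lra.
have t0 : 0 <= t by rewrite ler0n.
have m1 : 0 < errors by lra.
have [lnz tail] := crude_regime_bound n0 l2 b01 a1 m1 xi1 H.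
have := eloss_ge_wrong p_ge0 p_sum1 c_part h_max a sigmaP.
have a0 : 0 < a by lra.
have := wrong_tail_le a0 m1 (ltW t2m) lnz.
rewrite -/eloss -/errors -/bad -/n => T1 T2.
set w := fE p _ in T1 T2; have : w <= xi * errors := le_trans T1 tail.
by move: T2; lra.
Qed.

End FastBound.

(** * Lower deviations of pairs of class sizes under the prior *)

Section Unbalanced.
Context {R : realType} {I K : finType}.
Variables (q : K -> R) (b : R).
Hypothesis q_ge0 : forall k, 0 <= q k.
Hypothesis q_sum1 : \sum_k q k = 1.
Hypothesis b_ge0 : 0 <= b.
Hypothesis b_le : forall j k, j != k -> b <= q j + q k.

Let n : R := #|I|%:R.

Let p (i : I) := q.

(** The inverse of [1 + 1 / 2 + 1 / 8] is [8 / 13], below [5 / 8]. *)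
Lemma expRN_half_le : expR (- 2^-1) <= 5 / 8 :> R.
Proof.
have e1 : expR (- 2^-1) * expR 2^-1 = 1 :> R by rewrite -expRD addNr expR0.
have e2 := @expR_ge1DxD R 2^-1 ltac:(lra).
by have := expR_gt0 (- 2^-1 : R); nra.
Qed.

(** Chernoff bound with parameter [- 1 / 2]: each index contributes at most [expR (- (3 / 8) * b)],
    and [n * b / 4 - 3 * n * b / 8 = - n * b / 8]. *)
Lemma fE_two_classes_lt j k : j != k ->
  fE p (fun x => (((#|label_class x j| + #|label_class x k|)%:R : R) < n * b / 2)%R%:R) <=
  expR (- (n * b / 8)).
Proof.
move=> jk.
pose g l : R := expR (- 2^-1 * ((l == j) || (l == k))%:R).
have cnt x : (#|label_class x j| + #|label_class x k|)%:R =
    \sum_i ((x i == j) || (x i == k))%:R :> R.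
  rewrite natrD -(finset.setTI (label_class x j)) -(finset.setTI (label_class x k)).
  rewrite !natr_cardE -big_split; apply: eq_big => i; first by rewrite finset.inE.
  by move=> _; have [->|] := eqVneq (x i) j; rewrite /= ?(negbTE jk) ?addr0 ?add0r.
apply: (@le_trans _ _ (fE p (fun x => expR (n * b / 4) * \prod_i g (x i)))).
  apply: le_fE => // x; rewrite -expR_sum -mulr_sumr -cnt -expRD.
  case: ltP => [lt|_]; last exact: expR_ge0.
  by rewrite -[leLHS]expR0 ler_expR; lra.
rewrite fEZ (fE_prod p (fun _ => g)).
rewrite (_ : \prod_i _ = (\sum_l q l * g l) ^+ #|I|); last by rewrite -prodr_const.
have gE : \sum_l q l * g l = 1 + (q j + q k) * (expR (- 2^-1) - 1).
  rewrite -{1}q_sum1 (bigD1 j)//= (bigD1 k) 1?eq_sym//=.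
  rewrite [in RHS](bigD1 j)//= [in RHS](bigD1 k) 1?eq_sym//=.
  rewrite (eq_bigr q) => [|l /andP[/negbTE lj /negbTE lk]]; last first.
    by rewrite /g lj lk mulr0 expR0 mulr1.
  by rewrite /g !eqxx orbT /= mulr1; ring.
have gle : \sum_l q l * g l <= expR (- (3 / 8) * b).
  rewrite gE; apply: le_trans (expR_ge1Dx _).
  have v : expR (- 2^-1) - 1 <= - (3 / 8) :> R by have := expRN_half_le; lra.
  have := ler_wpM2l (addr_ge0 (q_ge0 j) (q_ge0 k)) v; have := b_le jk; lra.
have g0 : 0 <= \sum_l q l * g l.
  by apply: sumr_ge0 => l _; rewrite mulr_ge0 ?expR_ge0.
apply: le_trans (ler_wpM2l (expR_ge0 _) (lerXn2r _ _ _ gle)) _; rewrite ?nnegrE ?expR_ge0//.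
rewrite -expRM_natl -expRD ler_expR -/n; have : 0 <= n by rewrite ler0n.
by move: b_ge0; nra.
Qed.

(** Union bound over ordered pairs: a violating pair occurs in both orders, which pays for the
    factor 2. *)
Lemma fE_unbalanced_le :
  2 * fE p (fun x => (~~ balanced (n * b / 4) x)%:R) <=
  (#|K|)%:R ^+ 2 * expR (- (n * b / 8)).
Proof.
pose F j k (x : {ffun I -> K}) : R :=
  (((#|label_class x j| + #|label_class x k|)%:R : R) < n * b / 2)%R%:R.
have F0 j k x : 0 <= F j k x by rewrite ler0n.
apply: (@le_trans _ _ (fE p (fun x => \sum_(jk | jk.1 != jk.2) F jk.1 jk.2 x))).
  rewrite -fEZ; apply: le_fE => // x.
  case: (boolP (balanced _ x)) => [_|]; first by rewrite mulr0 sumr_ge0.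
  rewrite negb_forall => /existsP[j]; rewrite negb_forall => /existsP[k].
  rewrite negb_imply -ltNge => /andP[jk lt].
  have Fjk : F j k x = 1.
    have e : n * b / 2 = 2 * (n * b / 4) by lra.
    by rewrite /F e lt.
  have Fkj : F k j x = 1 by rewrite /F addnC -/(F j k x).
  rewrite (bigD1 (j, k))//= (bigD1 (k, j))/= ?Fjk ?Fkj.
    by rewrite mulr1 addrA lerDl sumr_ge0.
  by rewrite eq_sym jk xpair_eqE negb_and eq_sym jk.
rewrite fE_sum; apply: (@le_trans _ _ (\sum_(jk : K * K) expR (- (n * b / 8)))).
  rewrite [leRHS](bigID (fun jk => jk.1 != jk.2)) /= -[leLHS]addr0; apply: lerD.
    by apply: ler_sum => -[j k] /= jk; exact: fE_two_classes_lt.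
  by rewrite sumr_ge0// => jk _; exact: expR_ge0.
by rewrite sumr_const card_prod mulnn -[leLHS]mulr_natl natrX.
Qed.

End Unbalanced.

(** * Densities and changes of variables *)

Section Density.
Context d (T : measurableType d) (R : realType).
Variables (mu : {measure set T -> \bar R}) (f : T -> R).
Hypotheses (mf : measurable_fun setT f) (f_ge0 : forall x, 0 <= f x).
Local Open Scope ereal_scope.

(** The hypotheses on [f] are arguments so that the measure structure declared below attaches to the
    term itself. *)
Definition density & measurable_fun setT f & (forall x, (0 <= f x)%R) :
  set T -> \bar R := fun A => \int[mu]_(x in A) (f x)%:E.

Local Notation nu := (density mf f_ge0).

Let density0 : nu set0 = 0. Proof. exact: integral_set0. Qed.

Let density_ge0 A : 0 <= nu A.
Proof. by apply: integral_ge0 => x _; rewrite lee_fin. Qed.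

Let density_sigma_additive : semi_sigma_additive nu.
Proof.
apply: semi_sigma_additive_nng_induced; last by move=> x; rewrite lee_fin.
exact/measurable_EFinP.
Qed.

HB.instance Definition _ := isMeasure.Build _ _ _ nu
  density0 density_ge0 density_sigma_additive.

Import HBNNSimple.

Lemma integral_density_nnsfun (s : {nnsfun T >-> R}) :
  \int[nu]_x (s x)%:E = \int[mu]_x ((s x)%:E * (f x)%:E).
Proof.
have sA r : measurable (s @^-1` [set r]) by exact: measurable_sfunP.
rewrite integralT_nnsfun sintegralE.
transitivity (\int[mu]_x
    (\sum_(r \in range s) (r%:E * (\1_(s @^-1` [set r]) x)%:E * (f x)%:E))); last first.
  apply: eq_integral => x _.
  rewrite fimfunE -fsumEFin//= -ge0_mule_fsuml// => r.
  exact: nnfun_muleindic_ge0.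
rewrite ge0_integral_fsum//.
- apply: eq_fsbigr => r; rewrite inE => -[y _ yr].
  under eq_integral do rewrite -muleA.
  rewrite ge0_integralZl//.
  + congr (_ * _); rewrite -[LHS]/(\int[mu]_(x in s @^-1` [set r]) (f x)%:E).
    rewrite [LHS]integral_mkcond; apply: eq_integral => x _.
    by rewrite epatch_indic muleC.
  + apply: emeasurable_funM; last exact/measurable_EFinP.
    by apply/measurable_EFinP; exact: measurable_indic.
  + by move=> x _; rewrite -EFinM lee_fin mulr_ge0.
  + by rewrite lee_fin -yr.
- move=> r; apply: emeasurable_funM; last exact/measurable_EFinP.
  by apply/measurable_EFinP/measurable_funM => //; exact: measurable_indic.
- move=> r x _; rewrite mule_ge0 ?lee_fin//.
  exact: nnfun_muleindic_ge0.
Qed.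

Lemma ge0_integral_density (g : T -> R) : measurable_fun setT g ->
  (forall x, (0 <= g x)%R) ->
  \int[nu]_x (g x)%:E = \int[mu]_x ((g x)%:E * (f x)%:E).
Proof.
move=> mg g0.
have mg' : measurable_fun setT (EFin \o g) by exact/measurable_EFinP.
have g0' x : setT x -> 0 <= (EFin \o g) x by rewrite lee_fin.
pose s := nnsfun_approx measurableT mg'.
have s_cvg x : (s n x)%:E @[n --> \oo] --> (g x)%:E.
  exact: (cvg_nnsfun_approx measurableT mg' g0').
have s_nd x : {homo (fun n => (s n x)%:E) : m n / (m <= n)%N >-> m <= n}.
  by move=> m n mn; rewrite lee_fin; exact/lefP/nd_nnsfun_approx.
transitivity (\int[nu]_x limn (fun n => (s n x)%:E)).
  by apply: eq_integral => x _; exact/esym/cvg_lim.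
have s_meas n : measurable_fun setT (EFin \o s n) by exact/measurable_EFinP.
rewrite (monotone_convergence _ measurableT s_meas); last 2 first.
- by move=> n x _; rewrite lee_fin.
- by move=> x _; exact: s_nd.
under eq_fun do rewrite integral_density_nnsfun.
rewrite -monotone_convergence//.
- apply: eq_integral => x _; apply/cvg_lim => //.
  by apply: cvgeZr => //; exact: s_cvg.
- by move=> n; apply: emeasurable_funM; exact/measurable_EFinP.
- by move=> n x _; rewrite -EFinM lee_fin mulr_ge0.
- by move=> x _ m n mn; apply: lee_wpmul2r; [rewrite lee_fin|exact: s_nd].
Qed.

End Density.

(** The hypothesis says that the image by [phi] of the measure with density [G] has density [q]; the
    conclusion extends it from sets to functions by change of variables. *)
Lemma integral_transfer d1 d2 (X : measurableType d1) (Y : measurableType d2)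
    (R : realType) (mu1 : {measure set X -> \bar R})
    (mu2 : {measure set Y -> \bar R}) (phi : X -> Y) (G : X -> R) (q : Y -> R)
    (mphi : measurable_fun setT phi) (mG : measurable_fun setT G)
    (G_ge0 : forall x, 0 <= G x) (mq : measurable_fun setT q)
    (q_ge0 : forall y, 0 <= q y) :
  (forall B, measurable B ->
    (\int[mu1]_(x in phi @^-1` B) (G x)%:E = \int[mu2]_(y in B) (q y)%:E)%E) ->
  forall g : Y -> R, measurable_fun setT g -> (forall y, 0 <= g y) ->
  (\int[mu1]_x ((g (phi x))%:E * (G x)%:E) = \int[mu2]_y ((g y)%:E * (q y)%:E))%E.
Proof.
move=> GqB g mg g0.
rewrite -(ge0_integral_density mu2 mq q_ge0 mg g0).
have mgphi : measurable_fun setT (g \o phi) by exact: measurableT_comp.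
rewrite -(ge0_integral_density mu1 mG G_ge0 mgphi) => [|x]; last exact: g0.
have H := @ge0_integral_pushforward _ _ _ _ R phi mphi (density mu1 mG G_ge0)
  setT (EFin \o g) measurableT.
rewrite preimage_setT in H; rewrite -[LHS]H//.
- by apply: eq_measure_integral => B mB _; exact: GqB.
- exact/measurable_EFinP.
- by move=> y _; rewrite lee_fin.
Qed.

(** * Measurability of maps into finite types and integrals split along them *)

Section DiscreteMeasurability.
Context d (T : measurableType d).

Lemma measurable_discrete_set (F : finType) (f : T -> F) (B : set F) :
  measurable_discrete f -> measurable (f @^-1` B).
Proof.
move=> mf; rewrite (_ : f @^-1` B = \bigcup_(a in B) (f @^-1` [set a])).
  by apply: fin_bigcup_measurable => // a _; exact: mf.
by apply/seteqP; split => [x Bx|x [a Ba /= ->]//]; exists (f x).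
Qed.

Lemma measurable_fun_discrete d' (T' : measurableType d') (F : finType)
    (f : T -> F) (h : F -> T') :
  measurable_discrete f -> measurable_fun setT (h \o f).
Proof.
move=> mf _ B mB; rewrite setTI comp_preimage.
exact: measurable_discrete_set.
Qed.

Lemma measurable_discrete_comp (F F' : finType) (f : T -> F) (h : F -> F') :
  measurable_discrete f -> measurable_discrete (h \o f).
Proof. by move=> mf a; rewrite comp_preimage; exact: measurable_discrete_set. Qed.

Lemma measurable_discrete_pair (F F' : finType) (f : T -> F) (g : T -> F') :
  measurable_discrete f -> measurable_discrete g ->
  measurable_discrete (fun x => (f x, g x)).
Proof.
move=> mf mg [a b].
rewrite (_ : _ @^-1` _ = f @^-1` [set a] `&` g @^-1` [set b]).
  exact: measurableI.
by apply/seteqP; split => x /=; [case=> -> ->|case=> -> ->].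
Qed.

Lemma measurable_discrete_ffun (A F : finType) (f : A -> T -> F) :
  (forall a, measurable_discrete (f a)) ->
  measurable_discrete (fun x => [ffun a => f a x]).
Proof.
move=> mf u.
rewrite (_ : _ @^-1` _ = \bigcap_(a in [set: A]) (f a @^-1` [set u a])).
  by apply: fin_bigcap_measurable => // a _; exact: mf.
apply/seteqP; split => [x /= <- a _|x /= fu]; first by rewrite ffunE.
by apply/ffunP => a; rewrite ffunE; exact: fu.
Qed.

Lemma measurable_discrete_bool (b : T -> bool) :
  measurable_fun setT b -> measurable_discrete b.
Proof. by move=> mb a; rewrite -[_ @^-1` _]setTI; exact: mb. Qed.

Lemma ge0_integral_finpart (R : realType) (mu : {measure set T -> \bar R})
    (F : finType) (f : T -> F) (g : T -> R) :
  measurable_discrete f -> measurable_fun setT g -> (forall x, 0 <= g x) ->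
  (\int[mu]_x (g x)%:E = \sum_a \int[mu]_(x in f @^-1` [set a]) (g x)%:E)%E.
Proof.
move=> mf mg g0.
transitivity (\int[mu]_x (\sum_a (g x * \1_(f @^-1` [set a]) x)%:E))%E.
  apply: eq_integral => x _; rewrite sumEFin (bigD1 (f x))//= indicE mem_set//.
  rewrite mulr1 big1 ?addr0// => a /eqP afx; rewrite indicE memNset ?mulr0//.
  by move=> /esym.
have m_ind a : measurable_fun setT (fun x => (g x * \1_(f @^-1` [set a]) x)%:E).
  apply/measurable_EFinP; apply: measurable_funM; first exact: mg.
  by apply: measurable_indic; exact: mf.
rewrite (ge0_integral_sum _ measurableT m_ind).
  apply: eq_bigr => a _; rewrite [RHS]integral_mkcond.
  by apply: eq_integral => x _; rewrite epatch_indic EFinM.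
by move=> a x _; rewrite lee_fin mulr_ge0.
Qed.

End DiscreteMeasurability.

(** * Posterior law of the labels *)

Section Posterior.
Context {R : realType} {J : nat} {Y : ptopologicalType}
  {L : {sigma_finite_measure set (borel Y) -> \bar R}}.
Variable theta : hmm_param J L.
Hypothesis theta_in : theta_ind theta.
Context {dO : measure_display} {Omega : measurableType dO}.
Variable P : probability Omega R.
Variables (Xs : nat -> Omega -> 'I_J) (Ys : nat -> Omega -> borel Y).
Hypothesis XY_hmm : is_hmm theta P Xs Ys.

Definition prior (k : 'I_J) : R := nu theta ord0 k.

Lemma prior_ge0 k : 0 <= prior k. Proof. exact: nu_ge0. Qed.

Lemma prior_sum1 : \sum_k prior k = 1. Proof. exact: nu_sum1. Qed.

Definition mixture (y : borel Y) : R := \sum_k prior k * dens theta k y.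

(* Where the mixture density vanishes, the posterior is set to the prior, so
   that it is always a probability vector. *)
Definition posterior (k : 'I_J) (y : borel Y) : R :=
  if mixture y == 0 then prior k else prior k * dens theta k y / mixture y.

Lemma mixture_ge0 y : 0 <= mixture y.
Proof. by apply: sumr_ge0 => k _; rewrite mulr_ge0 ?nu_ge0 ?dens_ge0. Qed.

Lemma posterior_ge0 k y : 0 <= posterior k y.
Proof.
rewrite /posterior; case: ifP => _; first exact: nu_ge0.
by rewrite divr_ge0 ?mixture_ge0// mulr_ge0 ?nu_ge0 ?dens_ge0.
Qed.

Lemma posterior_sum1 y : \sum_k posterior k y = 1.
Proof.
rewrite /posterior; case: (eqVneq (mixture y) 0) => [_|m0]; first exact: prior_sum1.
by rewrite -mulr_suml divff.
Qed.

(** This also holds at the zeros of [mixture], where every nonnegative summand vanishes. *)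
Lemma posterior_mixture k y : posterior k y * mixture y = prior k * dens theta k y.
Proof.
rewrite /posterior; case: ifP => [/eqP m0|/negbT m0]; last by rewrite divfK.
rewrite m0 mulr0; move/eqP: m0; rewrite /mixture psumr_eq0 => [/allP/(_ k)|l _].
  by rewrite mem_index_enum /= => /(_ isT)/eqP->.
by rewrite mulr_ge0 ?nu_ge0 ?dens_ge0.
Qed.

Lemma measurable_mixture : measurable_fun setT mixture.
Proof.
apply: measurable_sum => k; apply: measurable_funM => //.
exact: measurable_dens.
Qed.

Lemma measurable_posterior k : measurable_fun setT (posterior k).
Proof.
apply: measurable_fun_ifT => //.
  by apply: measurable_fun_eqr => //; exact: measurable_mixture.
apply: measurable_funM; first by apply: measurable_funM => //; exact: measurable_dens.
(* On nonnegative reals the inverse is the power [-1], a measurable function. *)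
rewrite (_ : (fun y => (mixture y)^-1) = (@powR R ^~ (-1)) \o mixture).
  exact: (measurableT_comp (measurable_powR (-1)) measurable_mixture).
by apply/funext => y /=; rewrite powR_inv1// mixture_ge0.
Qed.

Definition emission (k : 'I_J) (A : set (borel Y)) : R :=
  (\int[L]_(y in A) dens theta k y)%R.

Lemma emissionE k A : measurable A ->
  (emission k A)%:E = (\int[L]_(y in A) (dens theta k y)%:E)%E.
Proof.
move=> mA; rewrite /emission /Rintegral fineK// ge0_fin_numE.
  apply: le_lt_trans (ltry 1); rewrite -(dens_int1 theta k).
  apply: ge0_subset_integral => //; last by move=> y _; rewrite lee_fin dens_ge0.
  by apply/measurable_EFinP; exact: measurable_dens.
by apply: integral_ge0 => y _; rewrite lee_fin dens_ge0.
Qed.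

Lemma mixture_emission A : measurable A ->
  (\int[L]_(y in A) (mixture y)%:E = (\sum_k prior k * emission k A)%:E)%E.
Proof.
move=> mA; under eq_integral do rewrite /mixture -sumEFin.
rewrite ge0_integral_sum//.
- rewrite -sumEFin; apply: eq_bigr => k _.
  under eq_integral do rewrite EFinM.
  rewrite ge0_integralZl ?lee_fin ?nu_ge0// ?EFinM ?emissionE//.
  + apply/measurable_EFinP; apply: measurable_funTS; exact: measurable_dens.
  + by move=> y _; rewrite lee_fin dens_ge0.
- move=> k; apply/measurable_EFinP; apply: measurable_funTS.
  by apply: measurable_funM => //; exact: measurable_dens.
- by move=> k y _; rewrite lee_fin mulr_ge0 ?nu_ge0 ?dens_ge0.
Qed.

Lemma chain_law (m : nat) (x : nat -> 'I_J) :
  P [set w | forall i, (i <= m)%N -> Xs i w = x i] =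
  (\prod_(i < m.+1) prior (x i))%:E.
Proof.
case: XY_hmm => _ _ [X0 XS] _.
elim: m => [|m IH].
  rewrite big_ord_recl big_ord0 mulr1 -(X0 (x 0%N)); congr (P _).
  apply/seteqP; split => w /=; first exact.
  by move=> w0 i; rewrite leqn0 => /eqP->.
rewrite XS IH [in RHS]big_ord_recr /= EFinM; congr (_ * _%:E)%E.
by rewrite /prior -(theta_in (x m)) mxE.
Qed.

Variable n : nat.
Hypothesis n_ge1 : (1 <= n)%N.

Definition labels (w : Omega) : {ffun 'I_n -> 'I_J} := [ffun i : 'I_n => Xs i w].

Lemma labels_eq x : labels @^-1` [set x] =
  \bigcap_(i in [set: 'I_n]) (Xs i @^-1` [set x i]).
Proof.
apply/seteqP; split => [w /= <- i _|w /= wx]; first by rewrite /= ffunE.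
by apply/ffunP => i; rewrite ffunE; exact: wx.
Qed.

Lemma measurable_labels : measurable_discrete labels.
Proof. by apply: measurable_discrete_ffun => i; case: XY_hmm. Qed.

Lemma labels_law (x : {ffun 'I_n -> 'I_J}) :
  P (labels @^-1` [set x]) = (\prod_i prior (x i))%:E.
Proof.
(* [chain_law] takes labels indexed by [nat], so [x] is extended by a default; only indices up to
   [n.-1] are read. *)
pose x' (i : nat) : 'I_J := odflt (x (Ordinal n_ge1)) (omap x (insub i)).
have x'E (i : 'I_n) : x' i = x i by rewrite /x' valK.
have := chain_law n.-1 x'; rewrite prednK//.
have -> : \prod_i prior (x i) = \prod_(i < n) prior (x' i).
  by apply: eq_bigr => i _; rewrite x'E.
move=> <-; congr (P _); apply/seteqP; split => w /=.
  move=> wx i; rewrite -ltnS prednK// => ni.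
  by rewrite -[i]/(nat_of_ord (Ordinal ni)) x'E -wx ffunE.
by move=> H; apply/ffunP => i; rewrite ffunE H ?x'E// -ltnS prednK.
Qed.

Lemma chain_sigma_labels (x : {ffun 'I_n -> 'I_J}) :
  chain_sigma Xs (labels @^-1` [set x]).
Proof.
rewrite labels_eq.
pose G := [set B | exists i x, B = Xs i @^-1` [set x]].
apply: (@fin_bigcap_measurable _ (g_sigma_algebraType G)) => // i _.
by apply: sub_sigma_algebra; exists (i : nat), (x i).
Qed.

Definition cylinder (A : 'I_n -> set (borel Y)) : set Omega :=
  [set w | forall i : 'I_n, A i (Ys i w)].

Lemma measurable_cylinder A : (forall i, measurable (A i)) -> measurable (cylinder A).
Proof.
move=> mA; rewrite (_ : cylinder A = \bigcap_(i in [set: 'I_n]) (Ys i @^-1` A i)).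
  apply: fin_bigcap_measurable => // i _; rewrite -[_ @^-1` _]setTI.
  by case: XY_hmm => _ mY _ _; exact: mY.
by apply/seteqP; split => w /= wA i; [move=> _|]; exact: wA.
Qed.

Lemma joint_cylinder (x : {ffun 'I_n -> 'I_J}) A : (forall i, measurable (A i)) ->
  P (labels @^-1` [set x] `&` cylinder A) =
  (\prod_i (prior (x i) * emission (x i) (A i)))%:E.
Proof.
move=> mA; case: XY_hmm => _ _ _ /(_ n A mA _ (chain_sigma_labels x)) ->.
rewrite (eq_integral (fun=> (\prod_i emission (x i) (A i))%:E)); last first.
  move=> w; rewrite inE /= => wx; congr (_%:E); apply: eq_bigr => i _.
  by rewrite /emission -wx ffunE.
rewrite integral_cst; last exact: measurable_labels.
by rewrite [X in (_ * X)%E](labels_law x) -EFinM mulrC -big_split.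
Qed.

Lemma measure_finpart (F : finType) (f : Omega -> F) E :
  measurable_discrete f -> measurable E ->
  P E = (\sum_a P (f @^-1` [set a] `&` E))%E.
Proof.
move=> mf mE.
have mI : measurable_fun setT (\1_E : Omega -> R) by exact: measurable_indic.
have := ge0_integral_finpart P mf mI (fun _ => ler0n _ _).
rewrite integral_indic// setIT => ->; apply: eq_bigr => a _.
by rewrite integral_indic// setIC.
Qed.

Lemma law_cylinder A : (forall i, measurable (A i)) ->
  P (cylinder A) = (\prod_i \sum_k prior k * emission k (A i))%:E.
Proof.
move=> mA; rewrite (measure_finpart measurable_labels (measurable_cylinder mA)).
rewrite bigA_distr_bigA -sumEFin; apply: eq_bigr => x _.
exact: joint_cylinder.
Qed.

End Posterior.

(** * Conditional law of the labels given the observations *)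

Section BayesFormula.
Context {R : realType} {J : nat} {Y : ptopologicalType}
  {L : {sigma_finite_measure set (borel Y) -> \bar R}}.
Variable theta : hmm_param J L.
Hypothesis theta_in : theta_ind theta.
Context {dO : measure_display} {Omega : measurableType dO}.
Variable P : probability Omega R.
Variables (Xs : nat -> Omega -> 'I_J) (Ys : nat -> Omega -> borel Y).
Hypothesis XY_hmm : is_hmm theta P Xs Ys.
Variable n : nat.
Hypothesis n_ge1 : (1 <= n)%N.

Let mYs i : measurable_fun setT (Ys i). Proof. by case: XY_hmm. Qed.

Local Notation posterior := (posterior theta).
Local Notation prior := (prior theta).
Local Notation emission := (emission theta).
Local Notation cylinder := (@cylinder Y dO Omega Ys n).

Let measurable_posteriors (x : {ffun 'I_n -> 'I_J}) (Q : pred 'I_n) :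
  measurable_fun setT (fun w => \prod_(i < n | Q i) posterior (x i) (Ys i w)).
Proof.
under eq_fun do rewrite big_mkcond /=.
apply: measurable_prod => i _; case: (Q i) => //.
exact: (measurableT_comp (measurable_posterior theta (x i)) (mYs i)).
Qed.

Let posteriors_ge0 (x : {ffun 'I_n -> 'I_J}) (Q : pred 'I_n) w :
  0 <= \prod_(i < n | Q i) posterior (x i) (Ys i w).
Proof. by apply: prodr_ge0 => i _; exact: posterior_ge0. Qed.

Let upd (A : 'I_n -> set (borel Y)) j B i := if i == j then B else A i.

Let measurable_upd A j B : (forall i, measurable (A i)) -> measurable B ->
  forall i, measurable (upd A j B i).
Proof. by move=> mA mB i; rewrite /upd; case: ifP. Qed.

Let cylinder_upd A j B : cylinder (upd A j B) =
  Ys j @^-1` B `&` cylinder (upd A j setT).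
Proof.
apply/seteqP; split => w; rewrite /cylinder /=.
  move=> wA; split=> [|i]; first by have := wA j; rewrite /upd eqxx.
  by have := wA i; rewrite /upd; case: eqP.
by move=> [wB wA] i; have := wA i; rewrite /upd; case: eqP => // ->.
Qed.

(* The indicators of the [A i] are replaced by [posterior (x i) * \1_(A i)] one
   coordinate at a time, the other coordinates acting as a fixed density. *)
Lemma integral_posteriors (x : {ffun 'I_n -> 'I_J}) m (A : 'I_n -> set (borel Y)) :
  (m <= n)%N -> (forall i, measurable (A i)) ->
  (\int[P]_(w in cylinder A)
     (\prod_(i < n | (i < m)%N) posterior (x i) (Ys i w))%:E =
   (\prod_(i < n) (if (i < m)%N then prior (x i) * emission (x i) (A i)
                   else \sum_k prior k * emission k (A i)))%:E)%E.
Proof.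
elim: m A => [|m IH] A mn mA.
  under eq_integral do rewrite big_pred0//.
  rewrite integral_cst; last exact: (measurable_cylinder XY_hmm).
  by rewrite mul1e; exact: (law_cylinder theta_in XY_hmm n_ge1 mA).
pose j := Ordinal mn.
pose C := \prod_(i < n | i != j) (if (i < m)%N then prior (x i) * emission (x i) (A i)
                   else \sum_k prior k * emission k (A i)).
have em_ge0 k B : 0 <= emission k B.
  by apply: Rintegral_ge0 => y _; exact: dens_ge0.
have C_ge0 : 0 <= C.
  apply: prodr_ge0 => i _; case: ifP => _; first by rewrite mulr_ge0 ?prior_ge0.
  by apply: sumr_ge0 => k _; rewrite mulr_ge0 ?prior_ge0.
(* Coordinate [j] is freed: weighted by [G], the law of [Ys j] has density [q] with respect to [L].
   Integrating [g] against it inserts the posterior of index [j], which [posterior_mixture] turns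
   into [prior * dens]. *)
pose A' := upd A j setT.
have mA' : measurable (cylinder A').
  by apply: (measurable_cylinder XY_hmm); exact: measurable_upd.
pose D w := \prod_(i < n | (i < m)%N) posterior (x i) (Ys i w).
pose G w := D w * \1_(cylinder A') w.
have mG : measurable_fun setT G.
  by apply: measurable_funM; [exact: measurable_posteriors|exact: measurable_indic].
have G_ge0 w : 0 <= G w by rewrite mulr_ge0// posteriors_ge0.
pose q y := C * mixture theta y.
have mq : measurable_fun setT q.
  by apply: measurable_funM => //; exact: measurable_mixture.
have q_ge0 y : 0 <= q y by rewrite mulr_ge0// mixture_ge0.
have GqE B : measurable B ->
    (\int[P]_(w in Ys j @^-1` B) (G w)%:E = \int[L]_(y in B) (q y)%:E)%E.
  move=> mB; transitivity (\int[P]_(w in cylinder (upd A j B)) (D w)%:E)%E.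
    rewrite cylinder_upd integral_mkcondr; apply: eq_integral => w _.
    by rewrite epatch_indic EFinM.
  rewrite IH ?(ltnW mn)//; last exact: measurable_upd.
  transitivity (C%:E * (\sum_k prior k * emission k B)%:E)%E.
    rewrite -EFinM; congr (_%:E); rewrite (bigD1 j)//= ltnn /upd eqxx mulrC.
    by congr (_ * _); apply: eq_bigr => i /negbTE->.
  rewrite -mixture_emission// -ge0_integralZl//.
  - by apply/measurable_EFinP/measurable_funTS; exact: measurable_mixture.
  - by move=> y _; rewrite lee_fin mixture_ge0.
pose g y := posterior (x j) y * \1_(A j) y.
have mg : measurable_fun setT g.
  apply: measurable_funM; first exact: measurable_posterior.
  exact: measurable_indic.
have g_ge0 y : 0 <= g y by rewrite mulr_ge0// posterior_ge0.
have := integral_transfer (mYs j) mG G_ge0 mq q_ge0 GqE mg g_ge0.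
have -> : (\int[P]_w ((g (Ys j w))%:E * (G w)%:E) =
    \int[P]_(w in cylinder A) (\prod_(i < n | (i < m.+1)%N) posterior (x i) (Ys i w))%:E)%E.
  rewrite [RHS]integral_mkcond; apply: eq_integral => w _.
  rewrite epatch_indic -!EFinM; congr (_%:E).
  have -> : \1_(cylinder A) w = \1_(A j) (Ys j w) * \1_(cylinder A') w :> R.
    have -> : cylinder A = Ys j @^-1` (A j) `&` cylinder A'.
      rewrite -cylinder_upd; congr cylinder; apply/funext => i.
      by rewrite /upd; case: eqP => // ->.
    by rewrite indicI.
  rewrite (bigD1 j)//= (eq_bigl (fun i : 'I_n => (i < m)%N)) => [|i].
    by rewrite /g /G /D; ring.
  by rewrite ltnS -val_eqE /= ltn_neqAle andbC.
move=> ->; transitivity (C%:E * (prior (x j) * emission (x j) (A j))%:E)%E; last first.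
  rewrite -EFinM; congr (_%:E); rewrite [RHS](bigD1 j)//= ltnS leqnn mulrC.
  congr (_ * _); apply: eq_bigr => i ij.
  by rewrite ltnS [in RHS]leq_eqVlt -[_ == m]/(val i == val j) val_eqE (negbTE ij).
rewrite EFinM emissionE// -ge0_integralZl ?lee_fin ?prior_ge0//; last 2 first.
- by apply/measurable_EFinP/measurable_funTS; exact: measurable_dens.
- by move=> y _; rewrite lee_fin dens_ge0.
rewrite -ge0_integralZl//; last 2 first.
- apply/measurable_EFinP/measurable_funTS.
  by apply: measurable_funM => //; exact: measurable_dens.
- by move=> y _; rewrite -EFinM lee_fin mulr_ge0 ?prior_ge0 ?dens_ge0.
rewrite [RHS]integral_mkcond; apply: eq_integral => y _.
rewrite epatch_indic -!EFinM; congr (_%:E).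
by rewrite -posterior_mixture /g /q; ring.
Qed.

Let mobs : measurable_fun setT (obs Ys n).
Proof.
apply/measurable_fun_tnthP => i.
rewrite (_ : _ \o _ = Ys i); first exact: mYs.
by apply/funext => w; rewrite /= tnth_mktuple.
Qed.

(** Both sides are measures of the observed event. They agree on cylinders, which are stable under
    intersection and generate the observations, and the left side is finite, so the two coincide. *)
Lemma bayes_formula (x : {ffun 'I_n -> 'I_J}) (B : set (n.-tuple (borel Y))) :
  measurable B ->
  P (labels Xs n @^-1` [set x] `&` obs Ys n @^-1` B) =
  (\int[P]_(w in obs Ys n @^-1` B) (\prod_i posterior (x i) (Ys i w))%:E)%E.
Proof.
move=> mB; have mx := measurable_labels XY_hmm x.
pose G0 := [set E | exists2 A, (forall i, measurable (A i)) & E = cylinder A].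
have mG : measurable_fun setT (fun w => \prod_i posterior (x i) (Ys i w)).
  exact: (measurable_posteriors x predT).
have G_ge0 w : 0 <= \prod_i posterior (x i) (Ys i w) by exact: (posteriors_ge0 x predT).
have cylT : cylinder (fun=> setT) = setT by apply/seteqP; split.
have G0T : G0 setT by exists (fun=> setT).
rewrite setIC -[LHS]/(mrestr P mx (obs Ys n @^-1` B)) -[RHS]/(density P mG G_ge0 _).
apply: (g_sigma_algebra_measure_unique G0 _ (fun=> setT)).
- by move=> _ [A mA ->]; exact: (measurable_cylinder XY_hmm).
- by [].
- by apply/seteqP; split => // w _; exists 0%N.
- move=> _ _ [A mA ->] [A' mA' ->]; exists (fun i => A i `&` A' i).
    by move=> i; exact: measurableI.
  apply/seteqP; split => w; rewrite /cylinder /=.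
    by move=> [wA wA'] i; split.
  by move=> wA; split=> i; case: (wA i).
- move=> _ [A mA ->]; rewrite -[LHS]/(P (cylinder A `&` labels Xs n @^-1` [set x])) setIC.
  rewrite [LHS](joint_cylinder theta_in XY_hmm n_ge1 x mA).
  transitivity (\prod_(i < n) (if (i < n)%N then prior (x i) * emission (x i) (A i)
                   else \sum_k prior k * emission k (A i)))%:E.
    by congr (_%:E); apply: eq_bigr => i _; rewrite ltn_ord.
  rewrite -integral_posteriors//; apply: eq_integral => w _; congr (_%:E).
  by apply: eq_bigl => i; rewrite ltn_ord.
- move=> _; rewrite -[ltLHS]/(P (setT `&` labels Xs n @^-1` [set x])) setTI.
  exact: le_lt_trans (probability_le1 P mx) (ltry 1).
- have mobs0 : @measurable_fun _ _ (g_sigma_algebraType G0) _ setT (obs Ys n).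
    apply/measurable_fun_tnthP => i _ A mA; rewrite setTI.
    have : G0 (Ys i @^-1` A).
      exists (upd (fun=> setT) i A); first exact: measurable_upd.
      rewrite cylinder_upd (_ : upd _ i setT = fun=> setT) ?cylT ?setIT//.
      by apply/funext => l; rewrite /upd; case: (l == i).
    rewrite (_ : _ @^-1` A = Ys i @^-1` A); first exact: sub_sigma_algebra.
    by apply/seteqP; split => w /=; rewrite tnth_mktuple.
  by rewrite -[_ @^-1` _]setTI; exact: mobs0.
Qed.

Lemma measurable_fE_posterior (F : finType) (phi : n.-tuple (borel Y) -> F)
    (H : F -> {ffun 'I_n -> 'I_J} -> R) : measurable_discrete phi ->
  measurable_fun setT
    (fun w => fE (fun (i : 'I_n) k => posterior k (Ys i w)) (H (phi (obs Ys n w)))).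
Proof.
move=> mphi.
have mphio : measurable_discrete (phi \o obs Ys n).
  by move=> a; rewrite comp_preimage -[_ @^-1` _]setTI; apply: mobs => //; exact: mphi.
rewrite /fE; apply: measurable_sum => x; apply: measurable_funM.
  exact: (measurable_posteriors x predT).
exact: (measurable_fun_discrete (fun a => H a x) mphio).
Qed.

(** Splitting along the finitely many values of [phi] and of the labels reduces the claim to
    [bayes_formula] on the preimages under [phi]. *)
Lemma integral_bayes (F : finType) (phi : n.-tuple (borel Y) -> F)
    (H : F -> {ffun 'I_n -> 'I_J} -> R) :
  measurable_discrete phi -> (forall a x, 0 <= H a x) ->
  (\int[P]_w (H (phi (obs Ys n w)) (labels Xs n w))%:E =
   \int[P]_w (fE (fun (i : 'I_n) k => posterior k (Ys i w)) (H (phi (obs Ys n w))))%:E)%E.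
Proof.
move=> mphi H0.
have mphio : measurable_discrete (phi \o obs Ys n).
  by move=> a; rewrite comp_preimage -[_ @^-1` _]setTI; apply: mobs => //; exact: mphi.
have mL := measurable_labels (n := n) XY_hmm.
rewrite (ge0_integral_finpart P mphio) => [|//|w]; last first.
- exact: H0.
- have := measurable_fun_discrete (fun ax => H ax.1 ax.2)
    (measurable_discrete_pair mphio mL); exact.
rewrite (ge0_integral_finpart P mphio) => [||w]; last first.
- apply: fE_ge0 => [i k|i|x]; [exact: posterior_ge0|exact: posterior_sum1|exact: H0].
- exact: (measurable_fE_posterior H mphi).
apply: eq_bigr => a _; have ma := mphio a.
transitivity (\sum_x (H a x)%:E *
    P (labels Xs n @^-1` [set x] `&` (phi \o obs Ys n) @^-1` [set a]))%E.
  transitivity (\int[P]_w (H a (labels Xs n w) * \1_((phi \o obs Ys n) @^-1` [set a]) w)%:E)%E.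
    rewrite integral_mkcond; apply: eq_integral => w _.
    rewrite epatch_indic -EFinM indicE; case: (boolP (w \in _)) => [|_]; last by rewrite !mulr0.
    by rewrite inE /= => ->.
  rewrite (ge0_integral_finpart P mL) => [||w]; last first.
  - by rewrite mulr_ge0.
  - apply: measurable_funM; last exact: measurable_indic.
    exact: (measurable_fun_discrete (H a) mL).
  apply: eq_bigr => x _.
  rewrite (eq_integral (fun w => (H a x)%:E * (\1_((phi \o obs Ys n) @^-1` [set a]) w)%:E)%E).
    rewrite ge0_integralZl ?lee_fin//; last by apply/measurable_EFinP; exact: measurable_indic.
    by rewrite integral_indic// setIC.
  by move=> w; rewrite inE /= => ->; rewrite EFinM.
transitivity (\sum_x (H a x)%:E * \int[P]_(w in (phi \o obs Ys n) @^-1` [set a])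
    (\prod_i posterior (x i) (Ys i w))%:E)%E.
  apply: eq_bigr => x _; congr (_ * _)%E; rewrite comp_preimage.
  by apply: bayes_formula; exact: mphi.
have mpost (x : {ffun 'I_n -> 'I_J}) : measurable_fun setT
    (fun w => (\prod_i posterior (x i) (Ys i w))%:E).
  by apply/measurable_EFinP; exact: (measurable_posteriors x predT).
have post0 (x : {ffun 'I_n -> 'I_J}) w : (0 <= (\prod_i posterior (x i) (Ys i w))%:E)%E.
  by rewrite lee_fin; exact: (posteriors_ge0 x predT).
under eq_bigr => x _.
  rewrite -ge0_integralZl ?lee_fin//; last by apply: measurable_funTS; exact: mpost.
  over.
rewrite -ge0_integral_sum//; last 2 first.
- move=> x; apply: measurable_funTS; apply: emeasurable_funM => //.
- by move=> x w _; rewrite mule_ge0 ?lee_fin.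
apply: eq_integral => w; rewrite inE /= => ->.
by rewrite /fE -sumEFin; apply: eq_bigr => x _; rewrite EFinM muleC.
Qed.

Lemma integral_labels (H : {ffun 'I_n -> 'I_J} -> R) : (forall x, 0 <= H x) ->
  (\int[P]_w (H (labels Xs n w))%:E = (fE (fun (_ : 'I_n) => prior) H)%:E)%E.
Proof.
move=> H0; have mL := measurable_labels (n := n) XY_hmm.
rewrite (ge0_integral_finpart P mL) => [|//|w]; last first.
- exact: H0.
- exact: (measurable_fun_discrete H mL).
rewrite /fE -sumEFin; apply: eq_bigr => x _.
rewrite (eq_integral (fun=> (H x)%:E)); last by move=> w; rewrite inE /= => ->.
rewrite integral_cst; last exact: mL.
by rewrite [X in (_ * X)%E](labels_law theta_in XY_hmm n_ge1 x) EFinM muleC.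
Qed.

End BayesFormula.

(** * Risks *)

Section ClusteringRisk.
Context {R : realType} {J : nat} {Y : ptopologicalType}
  {L : {sigma_finite_measure set (borel Y) -> \bar R}}.
Hypothesis J_ge2 : (2 <= J)%N.
Variable theta : hmm_param J L.
Hypothesis theta_in : theta_ind theta.
Context {dO : measure_display} {Omega : measurableType dO}.
Variable P : probability Omega R.
Variables (Xs : nat -> Omega -> 'I_J) (Ys : nat -> Omega -> borel Y).
Hypothesis XY_hmm : is_hmm theta P Xs Ys.
Variable n : nat.
Hypothesis n_ge1 : (1 <= n)%N.
Implicit Types (y : n.-tuple (borel Y)) (x : {ffun 'I_n -> 'I_J}).

Definition post y (i : 'I_n) (k : 'I_J) : R := posterior theta k (tnth y i).

Let post_ge0 y i k : 0 <= post y i k. Proof. exact: posterior_ge0. Qed.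

Let post_sum1 y i : \sum_k post y i k = 1. Proof. exact: posterior_sum1. Qed.

Let post_obs w : post (obs Ys n w) = fun i k => posterior theta k (Ys i w).
Proof. by apply/funext => i; apply/funext => k; rewrite /post tnth_mktuple. Qed.

(** All comparisons of masses, gathered in a finite-valued map, so that the choice of a best label
    is measurable as a function of it. *)
Definition mass_order y : {ffun {set 'I_n} * 'I_J * 'I_J -> bool} :=
  [ffun t => mass (post y) t.1.2 t.1.1 <= mass (post y) t.2 t.1.1].

Lemma measurable_mass_order : measurable_discrete mass_order.
Proof.
apply: measurable_discrete_ffun => t; apply: measurable_discrete_bool.
have mm k C : measurable_fun setT (fun y => mass (post y) k C).
  rewrite /mass; under eq_fun do rewrite big_mkcond /=.
  apply: measurable_sum => i; case: (i \in C) => //.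
  exact: (measurableT_comp (measurable_posterior theta k) (measurable_tnth i)).
exact: measurable_fun_ler.
Qed.

Definition best_label (b : {ffun {set 'I_n} * 'I_J * 'I_J -> bool}) (C : {set 'I_n}) : 'I_J :=
  odflt (Ordinal (ltnW J_ge2)) [pick k | [forall l, b (C, l, k)]].

(** A maximum over finitely many labels is attained, so [pick] succeeds on comparisons of actual
    masses. *)
Lemma best_label_max y k C :
  mass (post y) k C <= mass (post y) (best_label (mass_order y) C) C.
Proof.
rewrite /best_label; case: pickP => [l /forallP/(_ k)|none]; first by rewrite ffunE.
have [l _ lmax] := @arg_maxP _ _ _ k predT (fun l => mass (post y) l C) isT.
have := none l; rewrite (_ : [forall _, _] = true)//.
by apply/forallP => l'; rewrite ffunE; exact: lmax.
Qed.

Variable g : n.-tuple (borel Y) -> {set {set 'I_n}}.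
Hypothesis gP : clusterers Y n g.

Let g_part y : finset.partition (g y) finset.setT. Proof. by case: gP. Qed.

Let mg : measurable_discrete g. Proof. by case: gP. Qed.

Let h y := best_label (mass_order y).

Let h_max y k C : C \in g y -> mass (post y) k C <= mass (post y) (h y C) C.
Proof. by move=> _; exact: best_label_max. Qed.

Definition block_classifier y : n.-tuple 'I_J :=
  [tuple h y (finset.pblock (g y) i) | i < n].

Lemma measurable_block_classifier : classifiers Y J n block_classifier.
Proof.
apply: (measurable_discrete_comp
  (fun cb : {set {set 'I_n}} * {ffun {set 'I_n} * 'I_J * 'I_J -> bool} =>
     [tuple best_label cb.2 (finset.pblock cb.1 i) | i < n])
  (measurable_discrete_pair mg measurable_mass_order)).
Qed.

Let H_class (a : n.-tuple 'I_J) x : R := n%:R^-1 * \sum_(i < n) (tnth a i != x i)%:R.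

Let H_clust (c : {set {set 'I_n}}) x : R := clust_loss R c (label_partition x).

Let err y := errors (post y) (g y) (h y).

Lemma fE_class y : fE (post y) (H_class (block_classifier y)) = n%:R^-1 * err y.
Proof.
rewrite fEZ fE_sum; congr (_ * _).
rewrite /err /errors.
transitivity (\sum_i (1 - post y i (h y (finset.pblock (g y) i)))).
  apply: eq_bigr => i _; pose k := h y (finset.pblock (g y) i).
  transitivity (fE (post y) (fun x => 1 - (x i == k)%:R)); last first.
    by rewrite fEB fE_cst// fE_ind.
  apply: eq_fE => x; rewrite tnth_mktuple eq_sym -/k.
  by case: (x i == k); rewrite /= ?subrr ?subr0.
rewrite -(sum_blocks (g_part y)); apply: eq_bigr => C Cg; apply: eq_bigr => i iC.
have /and3P[_ tg _] := g_part y.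
by rewrite (finset.def_pblock tg Cg iC).
Qed.

Lemma clust_loss_ge0 c x : 0 <= H_clust c x.
Proof.
rewrite subr_ge0 mulrC ler_pdivrMr ?ltr0n// mul1r ler_nat.
apply/bigop.bigmax_leqP => M /matching_assignment[sigma _ le].
apply: (leq_trans le).
rewrite -[leqRHS](card_ord n) -(sum_card_label_class x).
by apply: leq_sum => k _; rewrite subset_leq_card// finset.subsetIr.
Qed.

Lemma exists_sigma y : exists sigma : {ffun 'I_n -> 'I_J} -> 'I_J -> {set 'I_n},
  forall x, assignment (g y) (sigma x) /\
    1 - n%:R^-1 * (score x (sigma x))%:R <= H_clust (g y) x.
Proof.
have /choice[sigma sigmaP] : forall x, exists s : 'I_J -> {set 'I_n},
    assignment (g y) s /\ 1 - n%:R^-1 * (score x s)%:R <= H_clust (g y) x.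
  by move=> x; have [s ? ?] := clust_loss_assignment R (g y) x; exists s.
by exists sigma.
Qed.

Lemma fE_clust_ge y : exists2 sigma : {ffun 'I_n -> 'I_J} -> 'I_J -> {set 'I_n},
  forall x, assignment (g y) (sigma x) &
  n%:R^-1 * fE (post y) (fun x => #|'I_n|%:R - (score x (sigma x))%:R)
    <= fE (post y) (H_clust (g y)).
Proof.
have [sigma sigmaP] := exists_sigma y; exists sigma => [x|].
  by case: (sigmaP x).
rewrite -fEZ; apply: le_fE => // x; rewrite card_ord mulrBr mulVf ?pnatr_eq0 -?lt0n//.
by case: (sigmaP x).
Qed.

Let u w : R := fE (post (obs Ys n w)) (H_clust (g (obs Ys n w))).
Let v w : R := n%:R^-1 * err (obs Ys n w).

Lemma clust_riskE : clust_risk P Xs Ys g = (\int[P]_w (u w)%:E)%E.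
Proof.
rewrite /clust_risk unlock.
have := integral_bayes theta_in XY_hmm n_ge1 mg clust_loss_ge0.
under [in RHS]eq_integral do rewrite -post_obs.
move=> <-; apply: eq_integral => w _; congr (clust_loss _ _ _)%:E.
by congr (label_partition _); apply/funext => i; rewrite ffunE.
Qed.

Lemma class_riskE : class_risk P Xs Ys block_classifier = (\int[P]_w (v w)%:E)%E.
Proof.
rewrite /class_risk unlock.
have H0 a x : 0 <= H_class a x.
  by rewrite mulr_ge0 ?invr_ge0// sumr_ge0.
have := integral_bayes theta_in XY_hmm n_ge1 measurable_block_classifier H0.
under [in RHS]eq_integral do rewrite -post_obs fE_class.
move=> <-; apply: eq_integral => w _; congr (_ * _)%:E.
by apply: eq_bigr => i _; rewrite ffunE.
Qed.

Let inv_n_gt0 : 0 < n%:R^-1 :> R. Proof. by rewrite invr_gt0 ltr0n. Qed.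

Let u_ge0 w : 0 <= u w.
Proof. by apply: fE_ge0 => // x; exact: clust_loss_ge0. Qed.

Let v_ge0 w : 0 <= v w.
Proof. by rewrite mulr_ge0 ?(ltW inv_n_gt0)//; exact: errors_ge0. Qed.

Let v_le1 w : v w <= 1.
Proof.
rewrite /v mulrC ler_pdivrMr ?ltr0n// mul1r /err (errorsE _ (g_part _)) card_ord.
by rewrite gerBl sumr_ge0// => C _; exact: mass_ge0.
Qed.

Let measurable_u : measurable_fun setT (EFin \o u).
Proof.
apply/measurable_EFinP; rewrite /u; under eq_fun do rewrite post_obs.
exact: (measurable_fE_posterior XY_hmm H_clust mg).
Qed.

Let measurable_v : measurable_fun setT (EFin \o v).
Proof.
apply/measurable_EFinP; rewrite /v.
under eq_fun do rewrite -fE_class post_obs.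
exact: (measurable_fE_posterior XY_hmm H_class measurable_block_classifier).
Qed.

Let eps : R := Num.sqrt (ln (J`!)%:R / (2 * n%:R)).

Let u_ge_hoeffding w : v w <= u w + eps.
Proof.
have [sigma sP ule] := fE_clust_ge (obs Ys n w).
rewrite -lerBlDr; apply: le_trans ule.
have := eloss_ge_hoeffding (post_ge0 _) (post_sum1 _) (g_part _) (@h_max (obs Ys n w)) sP.
rewrite !card_ord => /(_ J_ge2 n_ge1) H.
have := ler_wpM2l (ltW inv_n_gt0) H.
by rewrite mulrBr mulrA mulVf ?mul1r// pnatr_eq0 -lt0n.
Qed.

Let class_inf_le : (ereal_inf [set class_risk P Xs Ys h | h in classifiers Y J n] <=
  \int[P]_w (v w)%:E)%E.
Proof.
rewrite -class_riskE; apply: ereal_inf_lbound; exists block_classifier => //.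
exact: measurable_block_classifier.
Qed.

Lemma clust_risk_ge_hoeffding :
  (ereal_inf [set class_risk P Xs Ys h | h in classifiers Y J n] - eps%:E <=
   clust_risk P Xs Ys g)%E.
Proof.
rewrite clust_riskE leeBlDr//; apply: (le_trans class_inf_le).
have -> : (eps%:E = \int[P]_w (eps%:E))%E.
  by rewrite integral_cst// [X in (_ * X)%E](probability_setT P) mule1.
rewrite -ge0_integralD//; last 2 first.
- by move=> w _; rewrite lee_fin.
- by move=> w _; rewrite lee_fin sqrtr_ge0.
apply: ge0_le_integral => //.
- by move=> w _; rewrite lee_fin.
- exact: emeasurable_funD.
- by move=> w _; rewrite -EFinD lee_fin.
Qed.

Let b := beta (nu theta).
Let xi_n := xi (nu theta) n.
Let tail_n := J%:R ^+ 2 * expR (- (n%:R * b / 8)).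

Lemma beta_le j k : j != k -> b <= prior theta j + prior theta k.
Proof.
move=> jk; apply: ge_inf; last by exists (j, k).
by exists 0 => _ [jk' _ <-]; rewrite addr_ge0 ?nu_ge0.
Qed.

Lemma beta_le1 : b <= 1.
Proof.
pose j := Ordinal (ltnW J_ge2); pose k := Ordinal J_ge2.
have jk : j != k by [].
apply: (le_trans (beta_le jk)); rewrite -(prior_sum1 theta) (bigD1 j)//= lerD2l.
by rewrite (bigD1 k)//= lerDl sumr_ge0// => l _; exact: prior_ge0.
Qed.

Let bad w : R := fE (post (obs Ys n w)) (fun x => (~~ balanced (n%:R * b / 4) x)%:R).

Let bad_ge0 w : 0 <= bad w. Proof. exact: fE_ge0. Qed.

Let measurable_bad : measurable_fun setT (EFin \o bad).
Proof.
apply/measurable_EFinP; rewrite /bad; under eq_fun do rewrite post_obs.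
exact: (measurable_fE_posterior XY_hmm
  (fun _ x => (~~ balanced (n%:R * b / 4) x)%:R) mg).
Qed.

(** Averaging the posterior probability of imbalance over the observations gives its prior
    probability, under which the labels are independent with law [prior]. *)
Let bad_le : 0 <= b -> ((2%:R)%:E * \int[P]_w (bad w)%:E <= tail_n%:E)%E.
Proof.
move=> b0; pose H (_ : {set {set 'I_n}}) x : R := (~~ balanced (n%:R * b / 4) x)%:R.
have H0 c x : 0 <= H c x by rewrite ler0n.
have -> : (\int[P]_w (bad w)%:E = \int[P]_w (H finset.set0 (labels Xs n w))%:E)%E.
  rewrite (integral_bayes theta_in XY_hmm n_ge1 mg H0).
  by apply: eq_integral => w _; rewrite /bad post_obs.
rewrite (integral_labels theta_in XY_hmm n_ge1 (H0 _)) -EFinM lee_fin.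
have := fE_unbalanced_le (I := 'I_n) (prior_ge0 theta) (prior_sum1 theta) b0 beta_le.
by rewrite !card_ord.
Qed.

Let v_le_u_fast w : 0 < b -> 1 < n%:R * b / 4 -> xi_n < 1 ->
  (1 - xi_n) * v w <= u w + 2 * bad w.
Proof.
move=> b0 a1 xi1; have [sigma sP ule] := fE_clust_ge (obs Ys n w).
have b01 : 0 < b <= 1 by rewrite b0 beta_le1.
have cJ : (2 <= #|'I_J|)%N by rewrite card_ord.
have cn : (1 <= #|'I_n|)%N by rewrite card_ord.
have := @eloss_ge_fast _ _ _ _ (post_ge0 _) (post_sum1 _) _ (g_part _) _
  (@h_max (obs Ys n w)) _ sP cJ cn b.
rewrite !card_ord => /(_ b01 a1 xi1) H; rewrite card_ord in ule.
rewrite -lerBlDr; apply: le_trans ule.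
have -> : (1 - xi_n) * v w - 2 * bad w =
    n%:R^-1 * ((1 - xi_n) * err (obs Ys n w) - 2 * n%:R * bad w).
  by rewrite /v; field; rewrite pnatr_eq0 -lt0n.
exact: (ler_wpM2l (ltW inv_n_gt0) H).
Qed.

Lemma clust_risk_ge_fast : 0 < b ->
  ((1 - xi_n)%:E * ereal_inf [set class_risk P Xs Ys h | h in classifiers Y J n]
    - tail_n%:E <= clust_risk P Xs Ys g)%E.
Proof.
move=> b0; rewrite clust_riskE leeBlDr//.
set m := ereal_inf _.
have m0 : (0 <= m)%E.
  apply: le_ereal_inf_tmp => _ [h' _ <-]; rewrite /class_risk unlock.
  by apply: integral_ge0 => w _; rewrite lee_fin mulr_ge0 ?(ltW inv_n_gt0) ?sumr_ge0.
have m1 : (m <= 1)%E.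
  apply: (le_trans class_inf_le).
  have <- : (\int[P]_w (cst 1%:E w) = 1)%E.
    by rewrite integral_cst// [X in (_ * X)%E](probability_setT P) mule1.
  apply: ge0_le_integral => //.
  - by move=> w _; rewrite lee_fin.
  - by move=> w _; rewrite lee_fin.
have u0 : (0 <= \int[P]_w (u w)%:E)%E by apply: integral_ge0 => w _; rewrite lee_fin.
have tail0 : 0 <= tail_n by rewrite mulr_ge0 ?expR_ge0// exprn_ge0.
have xi0 : 0 <= xi_n.
  by rewrite mulr_ge0 ?powR_ge0// divr_ge0 ?(ltW b0)// mulr_ge0 ?expR_ge0.
have [xi1|xi1] := leP 1 xi_n.
  apply: (@le_trans _ _ 0%E); last by rewrite adde_ge0 ?lee_fin.
  by rewrite mule_le0_ge0// lee_fin subr_le0.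
(* When [n * b / 8 <= 1 / 2], [tail_n >= 4 * (1 - 1 / 2) >= 1], which exceeds the first term because
   the classification infimum [m] is at most 1. *)
have [a1|a1] := leP (n%:R * b / 4) 1.
  apply: (@le_trans _ _ (tail_n%:E)); last by rewrite leeDr.
  apply: (@le_trans _ _ 1%E).
    apply: (@le_trans _ _ (1 * m)%E); last by rewrite mul1e.
    by rewrite lee_wpmul2r// lee_fin gerBl.
  rewrite lee_fin /tail_n.
  have J4 : 4 <= J%:R ^+ 2 :> R.
    by rewrite -natrX (ler_nat R 4) (@leq_sqr 2 J).
  have := expR_ge1Dx (- (n%:R * b / 8)); have := expR_ge0 (- (n%:R * b / 8)).
  by move=> e0 e1; nra.
have xi1' : (0 <= (1 - xi_n)%:E)%E by rewrite lee_fin subr_ge0 ltW.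
apply: (le_trans (lee_wpmul2l xi1' class_inf_le)).
rewrite -ge0_integralZl//; last by move=> w _; rewrite lee_fin.
apply: (@le_trans _ _ (\int[P]_w ((u w)%:E + (2%:R)%:E * (bad w)%:E))%E).
  apply: ge0_le_integral => //.
  - by move=> w _; rewrite mule_ge0// lee_fin.
  - exact: emeasurable_funM.
  - by apply: emeasurable_funD => //; exact: emeasurable_funM.
  - by move=> w _; rewrite -!EFinM -EFinD lee_fin v_le_u_fast.
rewrite ge0_integralD//; last 3 first.
- by move=> w _; rewrite lee_fin.
- by move=> w _; rewrite -EFinM lee_fin mulr_ge0.
- exact: emeasurable_funM.
rewrite leeD2l// ge0_integralZl//; first by apply: bad_le; exact: ltW.
by move=> w _; rewrite lee_fin.
Qed.

End ClusteringRisk.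
Theorem theorem7 (R : realType) (J : nat) (J_ge2 : (2 <= J)%N)
    (Y : ptopologicalType) (Y_polish : polish R Y)
    (L : {sigma_finite_measure set (borel Y) -> \bar R})
    (theta : hmm_param J L) (theta_in : theta_ind theta)
    (dO : measure_display) (Omega : measurableType dO)
    (P : probability Omega R)
    (Xs : nat -> Omega -> 'I_J) (Ys : nat -> Omega -> borel Y)
    (XY_hmm : is_hmm theta P Xs Ys)
    (n : nat) (n_ge1 : (1 <= n)%N) :
  (ereal_inf [set clust_risk P Xs Ys g | g in clusterers Y n] >=
   ereal_inf [set class_risk P Xs Ys h | h in classifiers Y J n]
   - (Num.sqrt (ln (J`!)%:R / (2 * n%:R)))%:E)%E /\
  (0 < beta (nu theta) ->
   (ereal_inf [set clust_risk P Xs Ys g | g in clusterers Y n] >=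
    (1 - xi (nu theta) n)%:E *
      ereal_inf [set class_risk P Xs Ys h | h in classifiers Y J n]
    - (J%:R ^+ 2 * expR (- (n%:R * beta (nu theta) / 8)))%:E)%E).
Proof.
split=> [|b_gt0]; apply: le_ereal_inf_tmp => _ [g gP <-].
  exact: clust_risk_ge_hoeffding.
exact: clust_risk_ge_fast.
Qed.
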